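(* On infinite domains all dependence atoms are definable in terms of $2$-ary dependence atoms: for every dependence atom ${=}(\vec x,y)$ there is a formula $\phi$ of the extension of first order logic by $2$-ary dependence atoms, with free variables among those of the atom, such that $M\models_T{=}(\vec x,y)\iff M\models_T\phi$ for all infinite models $M$ and all teams $T$ in $M$ whose domain contains the variables of the atom. Respectively, on infinite domains the ternary independence atom $xyz\perp uvw$ can express all dependence, independence (pure and conditional), inclusion, anonymity, and exclusion atoms: for every such atom $\alpha$ there is a formula $\phi$ of the extension of first order logic by the atom $xyz\perp uvw$, with free variables among those of $\alpha$, such that $M\models_T\alpha\iff M\models_T\phi$ for all infinite models $M$ and all teams $T$ in $M$ whose domain contains the variables of $\alpha$.
   Context: A team $T$ in a model $M$ with domain a finite set of variables is a set of assignments from these variables to $M$; $s(a/x)$ is the assignment agreeing with $s$ except that $x\mapsto a$. Team semantics. For a first-order literal $\phi$ (atomic or negated atomic, including equality): $M\models_T\phi$ iff every $s\in T$ satisfies $\phi$. $M\models_T\phi\wedge\psi$ iff $M\models_T\phi$ and $M\models_T\psi$. $M\models_T\phi\vee\psi$ iff $T=U\cup V$ for some $U,V$ with $M\models_U\phi$, $M\models_V\psi$. $M\models_T\exists x\phi$ iff there is $F:T\to\mathcal P(M)\setminus\{\emptyset\}$ with $M\models_{T[F/x]}\phi$, where $T[F/x]=\{s(a/x):s\in T,a\in F(s)\}$. $M\models_T\forall x\phi$ iff $M\models_{T[M/x]}\phi$, where $T[M/x]=\{s(a/x):s\in T,a\in M\}$. Atoms (tuples of variables). Dependence: $M\models_T{=}(\vec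 x,y)$ iff $s(\vec x)=s'(\vec x)$ implies $s(y)=s'(y)$ for all $s,s'\in T$; it is $k$-ary if $\mathrm{len}(\vec x)=k$. Exclusion: $M\models_T\vec x\mid\vec y$ iff $s(\vec x)\neq s'(\vec y)$ for all $s,s'\in T$ ($\mathrm{len}(\vec x)=\mathrm{len}(\vec y)>0$). Inclusion: $M\models_T\vec x\subseteq\vec y$ iff for every $s\in T$ there is $s'\in T$ with $s(\vec x)=s'(\vec y)$ ($\mathrm{len}(\vec x)=\mathrm{len}(\vec y)>0$). Anonymity: $M\models_T\vec x\,\Upsilon\,y$ iff for every $s\in T$ there is $s'\in T$ with $s(\vec x)=s'(\vec x)$ and $s(y)\ne s'(y)$ ($\vec x$ non-empty). Independence: $M\models_T\vec x\perp_{\vec z}\vec y$ iff for all $s,s'\in T$ with $s(\vec z)=s'(\vec z)$ there is $s''\in T$ with $s''(\vec z)=s(\vec z)$, $s''(\vec x)=s(\vec x)$, $s''(\vec y)=s'(\vec y)$ ($\vec x,\vec y$ non-empty); $\vec x\perp\vec y$ is the (pure) case of empty $\vec z$. The extension of first order logic by given atoms is the closure of first-order literals and the given atoms (applied to arbitrary tuples of variables of the appropriate lengths) under $\wedge,\vee,\exists,\forall$. *)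

(* Defs.v *)
From mathcomp Require Import all_boot finmap.
From mathcomp Require Import boolp classical_sets functions cardinality.

Set Implicit Arguments.
Unset Strict Implicit.
Unset Printing Implicit Defensive.

Local Open Scope classical_set_scope.

Definition var := nat.

Record signature := Signature {
  fsym : Type;
  rsym : Type;
  far : fsym -> nat;
  rar : rsym -> nat
}.

Record model (L : signature) := Model {
  carrier :> Type;
  fint : forall f : fsym L, ('I_(far f) -> carrier) -> carrier;
  rint : forall r : rsym L, ('I_(rar r) -> carrier) -> Prop
}.

Inductive term (L : signature) :=
| Var of var
| App (f : fsym L) of ('I_(far f) -> term L).

Inductive literal (L : signature) :=
| Eq of term L & term L
| Neq of term L & term L
| Rel (r : rsym L) of ('I_(rar r) -> term L)
| NRel (r : rsym L) of ('I_(rar r) -> term L).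

(* [Indep xs zs ys] is the conditional atom xs _||_zs ys; the pure atom
   xs _||_ ys is the case zs = [::]. *)
Inductive atom :=
| Dep of seq var & var
| Excl of seq var & seq var
| Incl of seq var & seq var
| Anon of seq var & var
| Indep of seq var & seq var & seq var.

Definition wf_atom (a : atom) : bool :=
  match a with
  | Dep _ _ => true
  | Excl xs ys | Incl xs ys => (size xs == size ys) && (0 < size xs)
  | Anon xs _ => 0 < size xs
  | Indep xs _ ys => (0 < size xs) && (0 < size ys)
  end.

Definition kary_dep (k : nat) (a : atom) : bool :=
  if a is Dep xs _ then size xs == k else false.

Definition ternary_indep (a : atom) : bool :=
  if a is Indep xs zs ys then [&& size xs == 3, size zs == 0 & size ys == 3]
  else false.

Inductive formula (L : signature) :=
| Lit of literal L
| Atm of atom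
| And of formula L & formula L
| Or of formula L & formula L
| Ex of var & formula L
| All of var & formula L.

Arguments Atm {L}.

(* Membership in the extension of first-order logic by the atoms in [P]. *)
Fixpoint in_FO (L : signature) (P : pred atom) (phi : formula L) : Prop :=
  match phi with
  | Lit _ => True
  | Atm a => P a
  | And phi psi | Or phi psi => in_FO P phi /\ in_FO P psi
  | Ex _ phi | All _ phi => in_FO P phi
  end.

Definition atom_vars (a : atom) : seq var :=
  match a with
  | Dep xs y | Anon xs y => rcons xs y
  | Excl xs ys | Incl xs ys => xs ++ ys
  | Indep xs zs ys => xs ++ zs ++ ys
  end.

Fixpoint term_vars (L : signature) (t : term L) : set var :=
  match t with
  | Var x => [set x]
  | App _ ts => \bigcup_i term_vars (ts i)
  end.

Definition literal_vars (L : signature) (l : literal L) : set var :=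
  match l with
  | Eq t u | Neq t u => term_vars t `|` term_vars u
  | Rel _ ts | NRel _ ts => \bigcup_i term_vars (ts i)
  end.

Fixpoint free_vars (L : signature) (phi : formula L) : set var :=
  match phi with
  | Lit l => literal_vars l
  | Atm a => [set` atom_vars a]
  | And phi psi | Or phi psi => free_vars phi `|` free_vars psi
  | Ex x phi | All x phi => free_vars phi `\ x
  end.

Definition assignment (M : Type) := {fmap var -> M}.

Definition team_on (M : Type) (D : {fset var}) (T : set (assignment M)) : Prop :=
  forall s, T s -> domf s = D.

(* The value of a tuple is a tuple of options because assignments are partial;
   all entries are of the form [Some _] when the variables are in the domain. *)
Definition tuple_val (M : Type) (s : assignment M) (xs : seq var) :
  seq (option M) := [seq fnd s x | x <- xs].

(* [term_val s t a]: the term t is defined under s and has value a. *)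
Fixpoint term_val (L : signature) (M : model L) (s : assignment M)
    (t : term L) (a : M) : Prop :=
  match t with
  | Var x => fnd s x = Some a
  | App f ts => exists v, (forall i, term_val s (ts i) (v i)) /\ a = @fint L M f v
  end.

Definition literal_holds (L : signature) (M : model L) (s : assignment M)
    (l : literal L) : Prop :=
  match l with
  | Eq t u => exists a b : M, [/\ term_val s t a, term_val s u b & a = b]
  | Neq t u => exists a b : M, [/\ term_val s t a, term_val s u b & a <> b]
  | Rel r ts => exists v, (forall i, term_val s (ts i) (v i)) /\ @rint L M r v
  | NRel r ts => exists v, (forall i, term_val s (ts i) (v i)) /\ ~ @rint L M r v
  end.

Definition atom_holds (M : Type) (T : set (assignment M)) (a : atom) : Prop :=
  match a with
  | Dep xs y => forall s s', T s -> T s' ->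
      tuple_val s xs = tuple_val s' xs -> fnd s y = fnd s' y
  | Excl xs ys => forall s s', T s -> T s' -> tuple_val s xs <> tuple_val s' ys
  | Incl xs ys => forall s, T s ->
      exists2 s', T s' & tuple_val s xs = tuple_val s' ys
  | Anon xs y => forall s, T s -> exists s',
      [/\ T s', tuple_val s xs = tuple_val s' xs & fnd s y <> fnd s' y]
  | Indep xs zs ys => forall s s', T s -> T s' ->
      tuple_val s zs = tuple_val s' zs ->
      exists s'', [/\ T s'', tuple_val s'' zs = tuple_val s zs,
        tuple_val s'' xs = tuple_val s xs & tuple_val s'' ys = tuple_val s' ys]
  end.

Definition update (M : Type) (s : assignment M) (x : var) (a : M) :
  assignment M := setf s x a.

Definition supplement (M : Type) (T : set (assignment M)) (x : var)
    (F : assignment M -> set M) : set (assignment M) :=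
  [set s' | exists s a, [/\ T s, F s a & s' = update s x a]].

Fixpoint sat (L : signature) (M : model L) (T : set (assignment M))
    (phi : formula L) : Prop :=
  match phi with
  | Lit l => forall s, T s -> literal_holds s l
  | Atm a => atom_holds T a
  | And phi psi => sat T phi /\ sat T psi
  | Or phi psi => exists U V, [/\ T = U `|` V, sat U phi & sat V psi]
  | Ex x phi => exists F : assignment M -> set M,
      (forall s, T s -> F s !=set0) /\ sat (supplement T x F) phi
  | All x phi => sat (supplement T x (fun=> setT)) phi
  end.

Definition defines_on_infinite (L : signature) (phi : formula L) (a : atom) :
    Prop :=
  forall M : model L, infinite_set [set: M] ->
  forall (D : {fset var}) (T : set (assignment M)), team_on D T ->
  [set` atom_vars a] `<=` [set` D] ->
  sat T (Atm a) <-> sat T phi.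

(* Main.v *)
Require Import Defs.
From mathcomp Require Import all_boot finmap.
From mathcomp Require Import boolp classical_sets functions cardinality.

Set Implicit Arguments.
Unset Strict Implicit.
Unset Printing Implicit Defensive.

Local Open Scope classical_set_scope.

(** An infinite set [M] carries an injection [M * M -> M], hence, for every [n],
an injective code of the [n]-tuples by elements of [M].  In team semantics, the
dependence atoms [=(xs, p)] and [=(p, x_i)] say that [p] is an injective code
of the tuple [xs] on the team, and every atom that only compares values of [xs]
with one another may then read [p] instead of [xs] ([definable_code]).

With 2-ary dependence atoms one codes two variables at a time: [=(x1 x2 vs, y)]
becomes [exists p] ([p] codes [x1 x2] and [=(p vs, y)]), which gives all
dependence atoms by induction on the length ([definable_dep]).

The atom [x1 x2 x3 _||_ y1 y2 y3] first gives the 2-ary dependence atoms: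
[=(x y, z)] says that some function takes [x y] to [z], and the graph of such a
function is the set of values of [u u' v] in
[forall u u' exists v (u u' v _||_ x y z /\ (u <> x \/ u' <> y \/ v = z))]
([definable_indep3_dep2]).  Independence of [u u' v] from [x y z] makes the
choice of the graph uniform over the team.  Coding then gives pure independence
atoms of all lengths ([definable_pure_indep]), and from these
- inclusion, written [xs <= ys] here, as
  [forall v1 v2 v3 exists ws (ws _||_ v1 v2 /\
     ((v1 = v2 = v3 /\ ws = xs) \/ (~ (v1 = v2 = v3) /\ ws = ys)))]:
  every value of [xs] occurs as a value of [ws] with [v1 = v2], so by
  independence also with [v1 <> v2], where [ws = ys] ([definable_incl]);
- anonymity of [y] over [xs], as [exists y' (y' <> y /\ xs y' <= xs y)]
  ([definable_anon]);
- exclusion [xs | ys], as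
  [exists ws (ys <= ws /\ xs _||_ ws /\ xs <> ws)]: here [ws] is an independent
  copy of [ys] ([definable_excl]);
- conditional independence, after coding each of its three tuples by one
  variable, as [exists z' y' (z x y _||_ z' y' /\ z y <= z' y' /\
     (z <> z' \/ z x y' <= z x y))]: again [z' y'] is an independent copy of
  [z y], so that the rows with [z = z'] run through the pairs of assignments
  of the team which agree on [z] ([definable_indep1]).

The matrices of these formulas use atoms that are themselves only definable;
[definable_by] replaces them by their definitions. *)

(** * Pairing functions on infinite sets *)

(** Zorn's lemma for families of sets closed under directed unions, with a
maximal member above a given one. *)
Lemma Zorn_bigcup_above (T : Type) (P : set (set T)) (G0 : set T) :
  P G0 ->
  (forall F : set (set T), F !=set0 -> F `<=` P ->
     (forall G G', F G -> F G' -> exists H, [/\ F H, G `<=` H & G' `<=` H]) ->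
     P (\bigcup_(X in F) X)) ->
  exists A, [/\ P A, G0 `<=` A & forall B, P B -> A `<=` B -> B `<=` A].
Proof.
move=> PG0 chainP.
have [F FP Ftot|A [PA Amax]] := @Zorn_bigcup T [set A | P (A `|` G0)].
  rewrite /=; have -> : \bigcup_(X in F) X `|` G0 =
      \bigcup_(X in [set G0] `|` [set X `|` G0 | X in F]) X.
    rewrite bigcup_setU bigcup_set1 bigcup_image /=.
    apply/seteqP; split=> x.
      by case=> [[X FX Xx]|]; [right; exists X => //; left|left].
    by case=> [?|[X FX [Xx|]]]; [right|left; exists X|right].
  apply: chainP; first by exists G0; left.
    by move=> _ [->|[X /FP PX <-]].
  move=> _ _ [->|[X FX <-]] [->|[Y FY <-]].
  - by exists G0; split=> //; left.
  - by exists (Y `|` G0); split; [right; exists Y|move=> x ?; right|].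
  - by exists (X `|` G0); split; [right; exists X| |move=> x ?; right].
  - have [XY|YX] := Ftot _ _ FX FY.
        by exists (Y `|` G0); split; [right; exists Y|exact: setSU|].
      by exists (X `|` G0); split; [right; exists X| |exact: setSU].
exists (A `|` G0); split=> // B PB AGB.
apply: contrapT => nBA; apply: (Amax B).
  split=> [x ?|BA]; [by apply: AGB; left | by apply: nBA => x /BA ?; left].
rewrite /=; suff -> : B `|` G0 = B by [].
by apply/seteqP; split=> x; [case=> // ?; apply: AGB; right|left].
Qed.

(** Comparability of cardinals, within one type. *)
Lemma injection_total (T : Type) (A B : set T) :
  (exists2 h : T -> T, (forall a, A a -> B (h a)) &
     (forall a a', A a -> A a' -> h a = h a' -> a = a')) \/
  (exists2 h : T -> T, (forall b, B b -> A (h b)) &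
     (forall b b', B b -> B b' -> h b = h b' -> b = b')).
Proof.
pose P (G : set (T * T)) := [/\ G `<=` A `*` B,
  (forall a b b', G (a, b) -> G (a, b') -> b = b') &
  (forall a a' b, G (a, b) -> G (a', b) -> a = a')].
have [|F _ FP Fdir|G [[GAB Gfun Ginj] _ Gmax]] := @Zorn_bigcup_above _ P set0.
- by split.
- split=> [p [G /FP[+ _ _]]|a b b' [G FG Gb] [G' FG' Gb']|
           a a' b [G FG Ga] [G' FG' Ga']]; first by apply.
  + have [H [/FP[_ Hfun _] GH G'H]] := Fdir _ _ FG FG'.
    exact: Hfun (GH _ Gb) (G'H _ Gb').
  + have [H [/FP[_ _ Hinj] GH G'H]] := Fdir _ _ FG FG'.
    exact: Hinj (GH _ Ga) (G'H _ Ga').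
have [Atot|] := pselect (forall a, A a -> exists b, G (a, b)).
  have /choice[h hP] a : exists b, A a -> G (a, b).
    by have [/Atot[b Gb]|nAa] := pselect (A a); [exists b|exists a].
  left; exists h => [a /hP /GAB[]//|a a' /hP Ga /hP Ga' haa'].
  by apply: Ginj Ga _; rewrite haa'.
move=> /existsNP[a /not_implyP[Aa nGa]].
right; suff Btot b : B b -> exists a, G (a, b).
  have /choice[h hP] b : exists a, B b -> G (a, b).
    by have [/Btot[c Gc]|nBb] := pselect (B b); [exists c|exists b].
  exists h => [b /hP /GAB[]//|b b' /hP Gb /hP Gb' hbb'].
  by apply: Gfun Gb _; rewrite hbb'.
move=> Bb; apply: contrapT => nGb; apply: (nGa); exists b.
apply: (Gmax (G `|` [set (a, b)])) => [|x Gx|]; [|by left|by right].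
split=> [x [/GAB//|->//]|c d d'|c c' d].
- case=> [Gd|[ca ->]] [Gd'|[]]; first exact: Gfun Gd Gd'.
  + by move=> ca _; case: nGa; exists d; rewrite -ca.
  + by case: nGa; exists d'; rewrite -ca.
  + by move=> _ ->.
- case=> [Gc|[-> db]] [Gc'|[]]; first exact: Ginj Gc Gc'.
  + by move=> _ db; case: nGb; exists c; rewrite -db.
  + by case: nGb; exists c'; rewrite -db.
  + by move=> ->.
Qed.

(** Hessenberg's theorem, as an injection.  A partial pairing is a set [G] of
triples [(a, b, c)] that is the graph of an injection [S * S -> S], where [S] is
the set of the [a] with some [(a, a, c)] in [G].  Take [G] maximal above a
pairing of a countable subset.  If the complement of [S] injects into [S], then
the whole type does, and inherits a pairing from [S]. Otherwise [S] has a copy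
in its complement, and [G] extends to the union of [S] and this copy, against
maximality. *)
Lemma infinite_pairing (T : Type) : infinite_set [set: T] ->
  exists p : T -> T -> T,
    forall a b a' b', p a b = p a' b' -> a = a' /\ b = b'.
Proof.
move=> Tinf.
have [i iinj] : exists i : nat -> T, injective i.
  have /infiniteP/card_leP[f] := Tinf.
  exists (fun n => set_val (f (SigSub (mem_set (I : [set: nat] n))))) => m n.
  by move=> /val_inj /(@inj _ _ _ f) H; have [] := H (in_setT _) (in_setT _).
pose S (G : set (T * T * T)) := [set a | exists c, G (a, a, c)].
pose good (G : set (T * T * T)) := [/\
  forall a b c, G (a, b, c) -> [/\ S G a, S G b & S G c],
  forall a b, S G a -> S G b -> exists c, G (a, b, c),
  forall a b c c', G (a, b, c) -> G (a, b, c') -> c = c' &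
  forall a b a' b' c, G (a, b, c) -> G (a', b', c) -> a = a' /\ b = b'].
pose G0 := [set (i (fst mn), i (snd mn), i (choice.pickle mn)) |
  mn in [set: nat * nat]].
have SG0 n : S G0 (i n) by exists (i (choice.pickle (n, n))), (n, n).
have goodG0 : good G0.
  split=> [_ _ _ [[m n] _ [<- <- <-]] //||a b c c'|a b a' b' c].
  - by move=> _ _ [_ [[m ?] _ [<- _ _]]] [_ [[n ?] _ [<- _ _]]];
      exists (i (choice.pickle (m, n))), (m, n).
  - by move=> [[m n] _ [<- <- <-]] [[m' n'] _ [/iinj-> /iinj-> <-]].
  - move=> [[m n] _ [<- <- <-]] [[m' n'] _ [<- <-]].
    by move=> /iinj/(pcan_inj choice.pickleK)[-> ->].
have [F [G1 FG1] Fgood Fdir|G [[GS Gtot Gfun Ginj] G0G Gmax]] :=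
    Zorn_bigcup_above goodG0.
  have SF G a : F G -> S G a -> S (\bigcup_(X in F) X) a.
    by move=> FG [c ?]; exists c, G.
  split=> [a b c [G FG Gabc]|a b [c [G FG Ga]] [d [G' FG' Gb]]|
           a b c c' [G FG Gabc] [G' FG' Gabc']|
           a b a' b' c [G FG Gabc] [G' FG' Gabc']].
  - have [/(_ _ _ _ Gabc)[Sa Sb Sc] _ _ _] := Fgood _ FG.
    by split; apply: (SF G).
  - have [H [FH GH G'H]] := Fdir _ _ FG FG'.
    have [_ Htot _ _] := Fgood _ FH.
    have [| |e He] := Htot a b; [by exists c; apply: GH|by exists d; apply: G'H|].
    by exists e, H.
  - have [H [/Fgood[_ _ Hfun _] GH G'H]] := Fdir _ _ FG FG'.
    exact: Hfun (GH _ Gabc) (G'H _ Gabc').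
  - have [H [/Fgood[_ _ _ Hinj] GH G'H]] := Fdir _ _ FG FG'.
    exact: Hinj (GH _ Gabc) (G'H _ Gabc').
have Si n : S G (i n) by have [c G0c] := SG0 n; exists c; apply: G0G.
have /choice[f0 f0P] (ab : T * T) :
    exists c, S G ab.1 -> S G ab.2 -> G (ab.1, ab.2, c).
  have [[/Gtot/[apply]-[c Gc]]|nS] := pselect (S G ab.1 /\ S G ab.2).
    by exists c.
  by exists ab.1 => Sa Sb; case: nS.
pose f a b := f0 (a, b).
have fP a b : S G a -> S G b -> G (a, b, f a b) by exact: (f0P (a, b)).
have fS a b : S G a -> S G b -> S G (f a b).
  by move=> Sa Sb; have [] := GS _ _ _ (fP _ _ Sa Sb).
have finj a b a' b' : S G a -> S G b -> S G a' -> S G b' ->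
    f a b = f a' b' -> a = a' /\ b = b'.
  move=> Sa Sb Sa' Sb' fE; apply: Ginj (fP _ _ Sa Sb) _.
  by rewrite fE; apply: fP.
have [[h hS hinj]|[h hS hinj]] := injection_total (~` S G) (S G).
  (* Elements of [S] and of its complement are told apart by tags [i 0], [i 1]. *)
  pose e a := if a \in S G then f a (i 0) else f (h a) (i 1).
  have eS a : S G (e a).
    rewrite /e; case: ifPn; rewrite ?(inE, notin_setE) => ?; apply: fS => //.
    exact: hS.
  have einj : injective e.
    move=> a b; rewrite /e; case: ifPn; rewrite ?(inE, notin_setE) => Sa;
      case: ifPn; rewrite ?(inE, notin_setE) => Sb /finj[]//; try exact: hS.
    - by move=> _ /iinj.
    - by move=> _ /iinj.
    - by move=> /hinj ->.
  exists (fun a b => f (e a) (e b)) => a b a' b' /finj[]//.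
  by move=> /einj-> /einj->.
(* [r] sends both [S] and its copy [h @` S] back to [S]. *)
pose X := S G `|` h @` S G.
have /choice[r rP] a :
    exists x, (S G a -> x = a) /\ (forall y, S G y -> a = h y -> x = y).
  have [Sa|nSa] := pselect (S G a).
    by exists a; split=> // y /hS nSy ay; subst a.
  have [[y Sy hy]|nh] := pselect ((h @` S G) a).
    by exists y; split=> // y' Sy' ay'; apply: hinj => //; rewrite -ay'.
  by exists a; split=> // y Sy ay; case: nh; exists y.
have rS a : X a -> S G (r a).
  move=> [Sa|[y Sy ya]]; first by rewrite (proj1 (rP a)).
  by rewrite (proj2 (rP a) _ Sy).
have rinj a b : X a -> X b -> (S G a <-> S G b) -> r a = r b -> a = b.
  move=> [Sa|[y Sy ya]] [Sb|[z Sz zb]] ab rab.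
  - by move: rab; rewrite (proj1 (rP a))// (proj1 (rP b)).
  - by case: (hS z Sz); rewrite zb; apply/ab.
  - by case: (hS y Sy); rewrite ya; apply/ab.
  - move: rab; rewrite (proj2 (rP a) _ Sy)// (proj2 (rP b) _ Sz)// => yz.
    by rewrite -ya -zb yz.
(* Pairs that are not in [S * S] go to [h @` S]; the tag [t] says which of their
   components lie in [S]. *)
pose t a b := i (if a \in S G then 0 else if b \in S G then 1 else 2).
pose g a b := h (f (f (r a) (r b)) (t a b)).
pose K := G `|` [set p | [/\ X p.1.1, X p.1.2, ~ (S G p.1.1 /\ S G p.1.2) &
  p.2 = g p.1.1 p.1.2]].
have gh a b : X a -> X b -> exists2 y, S G y & g a b = h y.
  move=> Xa Xb; exists (f (f (r a) (r b)) (t a b)) => //.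
  by apply: (fS); [apply: (fS); exact: rS|exact: Si].
have SK a : S K a -> X a.
  by move=> [c [Gc|[]//]]; left; exists c.
have KS a : X a -> S K a.
  move=> Xa; have [[c Gc]|nSa] := pselect (S G a); first by exists c; left.
  by exists (g a a); right; split=> //= -[].
have SGK : good K.
  split.
  - move=> a b c [/GS[Sa Sb Sc]|/= [Xa Xb _ ->]]; split; apply: KS => //;
      try by left.
    by have [y Sy ->] := gh _ _ Xa Xb; right; exists y.
  - move=> a b /SK Xa /SK Xb.
    have [[Sa Sb]|nab] := pselect (S G a /\ S G b).
      by exists (f a b); left; apply: fP.
    by exists (g a b); right.
  - move=> a b c c' [Gc|/= [_ _ nab ->]] [Gc'|/= [_ _ nab' ->]] //.
    + exact: Gfun Gc Gc'.
    + by case: nab'; have [] := GS _ _ _ Gc.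
    + by case: nab; have [] := GS _ _ _ Gc'.
  - move=> a b a' b' c [Gc|/= [Xa Xb nab ->]] [Gc'|/= [Xa' Xb' nab']].
    + exact: Ginj Gc Gc'.
    + move=> cE; have [_ _] := GS _ _ _ Gc; rewrite cE.
      by have [y /hS nSy ->] := gh _ _ Xa' Xb' => /nSy.
    + have [_ _] := GS _ _ _ Gc'.
      by have [y /hS nSy ->] := gh _ _ Xa Xb => /nSy.
    + have fr x y : X x -> X y -> S G (f (r x) (r y)).
        by move=> Xx Xy; apply: fS; exact: rS.
      have [Sf Sf'] := (fr _ _ Xa Xb, fr _ _ Xa' Xb').
      move=> /(hinj _ _ (fS _ _ Sf (Si _)) (fS _ _ Sf' (Si _))).
      move=> /(finj _ _ _ _ Sf (Si _) Sf' (Si _))[ff /iinj tt].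
      have [raa rbb] := finj _ _ _ _ (rS _ Xa) (rS _ Xb) (rS _ Xa') (rS _ Xb') ff.
      have [Sab Sab'] : (S G a <-> S G a') /\ (S G b <-> S G b').
        move: tt nab nab'; rewrite /t /=.
        by do 4?[case: ifPn; rewrite ?(inE, notin_setE) => ?] => // _ ? ?; tauto.
      by split; apply: rinj.
have GK : G `<=` K by move=> ? ?; left.
have /GS[_ _] : G (h (i 0), h (i 0), g (h (i 0)) (h (i 0))).
  apply: (Gmax K) => //; right; split=> //=; try by right; exists (i 0).
  by case=> Sh _; exact: (hS _ (Si 0)).
have [||y /hS nSy ->//] := gh (h (i 0)) (h (i 0)); by right; exists (i 0).
Qed.
Lemma infinite_neq (M : Type) (b : M) : infinite_set [set: M] -> exists c, c <> b.
Proof.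
move=> Minf; apply: contrapT => /forallNP H; apply: Minf.
suff -> : [set: M] = [set b] by exact: finite_set1.
by apply/seteqP; split=> // c _; apply: contrapT; exact: H.
Qed.

(** Injectivity is only claimed among tuples of the same length. *)
Lemma tuple_code (M : Type) : infinite_set [set: M] ->
  exists c : seq M -> M, forall t t', size t = size t' -> c t = c t' -> t = t'.
Proof.
move=> Minf; have [p pinj] := infinite_pairing Minf.
have [d _] := infinite_setN0 Minf.
exists (foldr p d); elim=> [|a t IH] [|a' t'] //= [st] /pinj[-> /IH->//].
Qed.

(** * Variants of assignments and blocks of quantifiers *)

(** [s'] is obtained from [s] by giving values to the variables in [ws],
overwriting their values under [s], if any. *)
Definition variant (M : Type) (ws : seq var) (s s' : assignment M) : Prop :=
  domf s' = (domf s `|` [fset x in ws])%fset /\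
  (forall x, x \notin ws -> fnd s' x = fnd s x).

Lemma variant_nil (M : Type) (s s' : assignment M) :
  variant [::] s s' <-> s' = s.
Proof.
split=> [[_ ss']|->]; first by apply/fmapP => x; exact: ss'.
split=> //; apply/fsetP => x; rewrite !inE /= orbF //.
Qed.

Lemma variant_cons (M : Type) w ws (s s' : assignment M) :
  variant (w :: ws) s s' <-> exists a, variant ws (update s w a) s'.
Proof.
split=> [[ds' ss']|[a [ds' ss']]].
- have ws' : w \in domf s' by rewrite ds' !inE eqxx orbT.
  have [a s'a] : exists a, fnd s' w = Some a by rewrite (in_fnd ws'); eexists.
  exists a; split=> [|x xws].
    by rewrite ds'; apply/fsetP => x; rewrite !inE; case: eqP; rewrite ?orbT.
  rewrite fnd_set; case: eqP => [->|/eqP xw]; first by [].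
  by rewrite ss' // inE negb_or xw.
- split=> [|x].
    by rewrite ds'; apply/fsetP => x; rewrite !inE; case: eqP; rewrite ?orbT.
  by rewrite inE negb_or => /andP[/negPf xw xws]; rewrite ss' // fnd_set xw.
Qed.

Lemma variant_cat (M : Type) us ws (s s' : assignment M) :
  variant (us ++ ws) s s' <-> exists2 s1, variant us s s1 & variant ws s1 s'.
Proof.
elim: us s => [|u us IH] s /=.
  split=> [ss'|[s1 /variant_nil -> //]].
  by exists s => //; apply/variant_nil.
rewrite variant_cons; split=> [[a /IH[s1 ss1 s1s']]|[s1 /variant_cons[a ss1] s1s']].
  by exists s1 => //; apply/variant_cons; exists a.
by exists a; apply/IH; exists s1.
Qed.

Lemma variant_tuple (M : Type) ws (s s' : assignment M) xs :
  variant ws s s' -> {in xs, forall x, x \notin ws} ->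
  tuple_val s' xs = tuple_val s xs.
Proof. by move=> [_ ss'] xsP; apply/eq_in_map => x /xsP; exact: ss'. Qed.

Lemma variant_tuple_exists (M : Type) ws (s : assignment M) (t : seq M) :
  uniq ws -> size t = size ws ->
  exists2 s', variant ws s s' & tuple_val s' ws = map some t.
Proof.
elim: ws t s => [|w ws IH] [|a t] s //=; first by exists s => //; apply/variant_nil.
move=> /andP[wws uws] [st]; have [s' ss' s't] := IH t (update s w a) uws st.
exists s'; first by apply/variant_cons; exists a.
by rewrite s't ss'.2 // fnd_set eqxx.
Qed.

(** Teams whose assignments are all defined on the variables in [S]. *)
Definition defined_on (M : Type) (S : seq var) (T : set (assignment M)) : Prop :=
  forall s x, T s -> x \in S -> x \in domf s.

Lemma defined_on_variant (M : Type) S ws (T T' : set (assignment M)) :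
  defined_on S T -> (forall s', T' s' -> exists2 s, T s & variant ws s s') ->
  defined_on (ws ++ S) T'.
Proof.
move=> TS T'T s' x /T'T[s Ts [ds' _]]; rewrite ds' mem_cat !inE orbC.
by case/orP => [/(TS s x Ts)->//|->]; rewrite orbT.
Qed.

Lemma fnd_some (M : Type) S (T : set (assignment M)) s x :
  defined_on S T -> T s -> x \in S -> exists a, fnd s x = Some a.
Proof. by move=> TS Ts /(TS s x Ts) xs; rewrite (in_fnd xs); eexists. Qed.

Lemma tuple_val_some (M : Type) S (T : set (assignment M)) s xs :
  defined_on S T -> T s -> {subset xs <= S} -> exists t, tuple_val s xs = map some t.
Proof.
move=> TS Ts; elim: xs => [|x xs IH] xsS; first by exists [::].
have [t tE] : exists t, tuple_val s xs = map some t.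
  by apply: IH => z zxs; apply: xsS; rewrite inE zxs orbT.
have xs_s : x \in domf s by apply: TS Ts _; apply: xsS; rewrite mem_head.
by rewrite /= tE (in_fnd xs_s); eexists (_ :: t).
Qed.

(** Blocks of quantifiers. *)
Definition Exs (L : signature) (ws : seq var) (phi : formula L) : formula L :=
  foldr (@Ex L) phi ws.

Definition Alls (L : signature) (ws : seq var) (phi : formula L) : formula L :=
  foldr (@All L) phi ws.

(** [T'] is a team that arises from [T] by existential quantification of [ws]:
its members are variants of members of [T], and each member of [T] has at least
one variant in [T']. *)
Definition variation (M : Type) ws (T T' : set (assignment M)) : Prop :=
  (forall s', T' s' -> exists2 s, T s & variant ws s s') /\
  (forall s, T s -> exists2 s', T' s' & variant ws s s').

(** The variants of members of [T] that satisfy [Phi]. *)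
Definition restricted_variation (M : Type) ws (T Phi : set (assignment M)) :=
  [set s' | Phi s' /\ exists2 s, T s & variant ws s s'].

Lemma variation_restricted (M : Type) ws (T Phi : set (assignment M)) :
  (forall s, T s -> exists2 s', variant ws s s' & Phi s') ->
  variation ws T (restricted_variation ws T Phi).
Proof.
move=> PhiP; split=> [s' []//|s Ts]; have [s' ss' Phis'] := PhiP s Ts.
by exists s' => //; split=> //; exists s.
Qed.

(** Existential blocks in terms of the resulting team instead of the choice
functions. *)
Lemma sat_Exs (L : signature) (M : model L) ws (T : set (assignment M)) phi :
  sat T (Exs ws phi) <-> exists2 T', variation ws T T' & sat T' phi.
Proof.
elim: ws T => [|w ws IH] T /=.
  split=> [phiT|[T' [T'T TT'] phiT']].
    by exists T => //; split=> s Ts; exists s => //; apply/variant_nil.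
  suff -> : T = T' by [].
  apply/seteqP; split=> s.
    by move=> /TT'[s' Ts' /variant_nil <-].
  by move=> /T'T[s' Ts' /variant_nil ->].
split=> [[F [F0 /IH[T' [T'T TT'] phiT']]]|[T' [T'T TT'] phiT']].
  exists T' => //; split=> [s' /T'T[_ [s [a [Ts Fsa ->]]] ss']|s Ts].
    by exists s => //; apply/variant_cons; exists a.
  have [a Fsa] := F0 _ Ts; have [|s' T's' ss'] := TT' (update s w a).
    by exists s, a.
  by exists s' => //; apply/variant_cons; exists a.
(* The value [a] is chosen when some variant of [update s w a] lies in [T']. *)
exists (fun s => [set a | exists2 s', T' s' & variant ws (update s w a) s']); split.
  by move=> s /TT'[s' T's' /variant_cons[a ss']]; exists a, s'.
apply/IH; exists T' => //; split.
  move=> s' T's'; have [s Ts /variant_cons[a ss']] := T'T _ T's'.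
  by exists (update s w a) => //; exists s, a; split => //; exists s'.
by move=> _ [s [a [Ts [s' T's' ss'] ->]]]; exists s'.
Qed.

Lemma sat_Alls (L : signature) (M : model L) ws (T : set (assignment M)) phi :
  sat T (Alls ws phi) <->
  sat [set s' | exists2 s, T s & variant ws s s'] phi.
Proof.
elim: ws T => [|w ws IH] T /=.
  suff -> : [set s' | exists2 s, T s & variant [::] s s'] = T by [].
  apply/seteqP; split=> s /=; first by move=> [s' Ts' /variant_nil ->].
  by move=> Ts; exists s => //; apply/variant_nil.
rewrite IH; set T1 := (X in sat X phi <-> _); set T2 := (X in _ <-> sat X phi).
suff -> : T1 = T2 by [].
apply/seteqP; split=> s' /=.
  move=> [_ [s [a [Ts _ ->]]] ss']; exists s => //.
  by apply/variant_cons; exists a.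
move=> [s Ts /variant_cons[a ss']]; exists (update s w a) => //.
by exists s, a.
Qed.

Lemma sat_AllsExs_intro (L : signature) (M : model L) us ws (T : set (assignment M))
    (Phi : set (assignment M)) phi :
  (forall s s1, T s -> variant us s s1 -> exists2 s', variant ws s1 s' & Phi s') ->
  sat (restricted_variation (us ++ ws) T Phi) phi ->
  sat T (Alls us (Exs ws phi)).
Proof.
move=> PhiP phiT'; apply/sat_Alls/sat_Exs; eexists; last exact: phiT'.
split=> [s' [_ [s Ts /variant_cat[s1 ss1 s1s']]]|s1 [s Ts ss1]].
  by exists s1 => //; exists s.
have [s' s1s' Phis'] := PhiP _ _ Ts ss1; exists s' => //.
by split=> //; exists s => //; apply/variant_cat; exists s1.
Qed.

Lemma sat_AllsExs_elim (L : signature) (M : model L) us ws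
    (T : set (assignment M)) phi :
  sat T (Alls us (Exs ws phi)) ->
  exists T' : set (assignment M), [/\ sat T' phi,
    (forall s', T' s' -> exists2 s, T s & variant (us ++ ws) s s') &
    (forall s s1, T s -> variant us s s1 -> exists2 s', T' s' & variant ws s1 s')].
Proof.
move=> /sat_Alls/sat_Exs[T' [T'T TT'] phiT']; exists T'; split=> //.
  move=> s' /T'T[s1 [s Ts ss1] s1s']; exists s => //.
  by apply/variant_cat; exists s1.
by move=> s s1 Ts ss1; apply: TT'; exists s.
Qed.

(** * Invariance of atoms under change of other variables *)

(** An atom only depends on the restrictions of the assignments to its
variables. *)
Lemma atom_holds_sub_transfer (M : Type) (T T' : set (assignment M)) a :
  (forall s', T' s' -> exists2 s, T s &
     {in atom_vars a, forall x, fnd s' x = fnd s x}) ->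
  (forall s, T s -> exists2 s', T' s' &
     {in atom_vars a, forall x, fnd s' x = fnd s x}) ->
  atom_holds T a -> atom_holds T' a.
Proof.
have tupleE (vs xs : seq var) (s s' : assignment M) : {subset xs <= vs} ->
    {in vs, forall x, fnd s' x = fnd s x} -> tuple_val s' xs = tuple_val s xs.
  by move=> xsvs ss'; apply/eq_in_map => x /xsvs; exact: ss'.
case: a => [xs y|xs ys|xs ys|xs y|xs zs ys] /= T'T TT' Ta.
- have xsP : {subset xs <= rcons xs y} by move=> x; rewrite mem_rcons inE orbC => ->.
  have yP : y \in rcons xs y by rewrite mem_rcons mem_head.
  move=> s' r' /T'T[s Ts ss'] /T'T[r Tr rr'].
  rewrite !(tupleE _ _ _ _ xsP ss', tupleE _ _ _ _ xsP rr') ss' // rr' //.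
  exact: Ta.
- have xsP : {subset xs <= xs ++ ys} by move=> x; rewrite mem_cat => ->.
  have ysP : {subset ys <= xs ++ ys} by move=> x; rewrite mem_cat orbC => ->.
  move=> s' r' /T'T[s Ts ss'] /T'T[r Tr rr'].
  by rewrite (tupleE _ _ _ _ xsP ss') (tupleE _ _ _ _ ysP rr'); exact: Ta.
- have xsP : {subset xs <= xs ++ ys} by move=> x; rewrite mem_cat => ->.
  have ysP : {subset ys <= xs ++ ys} by move=> x; rewrite mem_cat orbC => ->.
  move=> s' /T'T[s Ts ss']; have [r Tr sr] := Ta s Ts.
  have [r' Tr' rr'] := TT' r Tr; exists r' => //.
  by rewrite (tupleE _ _ _ _ xsP ss') (tupleE _ _ _ _ ysP rr').
- have xsP : {subset xs <= rcons xs y} by move=> x; rewrite mem_rcons inE orbC => ->.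
  have yP : y \in rcons xs y by rewrite mem_rcons mem_head.
  move=> s' /T'T[s Ts ss']; have [r [Tr sr ysr]] := Ta s Ts.
  have [r' Tr' rr'] := TT' r Tr; exists r'.
  by rewrite !(tupleE _ _ _ _ xsP ss', tupleE _ _ _ _ xsP rr') ss' // rr'.
- have xsP : {subset xs <= xs ++ zs ++ ys} by move=> x; rewrite mem_cat => ->.
  have zsP : {subset zs <= xs ++ zs ++ ys}.
    by move=> x; rewrite !mem_cat => ->; rewrite orbT.
  have ysP : {subset ys <= xs ++ zs ++ ys}.
    by move=> x; rewrite !mem_cat => ->; rewrite !orbT.
  move=> s' r' /T'T[s Ts ss'] /T'T[r Tr rr'].
  rewrite !(tupleE _ _ _ _ xsP ss', tupleE _ _ _ _ ysP rr').
  rewrite !(tupleE _ _ _ _ zsP ss', tupleE _ _ _ _ zsP rr') => zsr.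
  have [q [Tq qz qx qy]] := Ta _ _ Ts Tr zsr.
  have [q' Tq' qq'] := TT' q Tq; exists q'.
  by rewrite !(tupleE _ _ _ _ xsP qq', tupleE _ _ _ _ ysP qq', tupleE _ _ _ _ zsP qq').
Qed.

Lemma atom_holds_variation (M : Type) ws (T T' : set (assignment M)) a :
  variation ws T T' -> {in atom_vars a, forall x, x \notin ws} ->
  atom_holds T a <-> atom_holds T' a.
Proof.
move=> [T'T TT'] aws; split; apply: atom_holds_sub_transfer.
- by move=> s' /T'T[s Ts [_ ss']]; exists s => // x /aws; exact: ss'.
- by move=> s /TT'[s' Ts' [_ ss']]; exists s' => // x /aws; exact: ss'.
- by move=> s /TT'[s' Ts' [_ ss']]; exists s' => // x /aws xws; rewrite ss'.
- by move=> s' /T'T[s Ts [_ ss']]; exists s => // x /aws xws; rewrite ss'.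
Qed.

(** * Flat formulas and equality of tuples *)

(** On teams defined on [S], the formula [phi] holds exactly when all members
have the property [Q]. *)
Definition flat_on (L : signature) (M : model L) (S : seq var) (phi : formula L)
    (Q : assignment M -> Prop) : Prop :=
  forall T, defined_on S T -> sat T phi <-> (forall s, T s -> Q s).

Local Notation EqV x y := (Lit (Eq (Var _ x) (Var _ y))).
Local Notation NeqV x y := (Lit (Neq (Var _ x) (Var _ y))).

Lemma flat_EqV (L : signature) (M : model L) S x y : x \in S -> y \in S ->
  flat_on S (EqV x y : formula L) (fun s : assignment M => fnd s x = fnd s y).
Proof.
move=> xS yS T TS /=; split=> [H s /H[a [b [-> -> ->]]]//|H s Ts].
have := H s Ts; rewrite (in_fnd (TS s x Ts xS)) (in_fnd (TS s y Ts yS)) => -[?].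
by do 2!eexists.
Qed.

Lemma flat_NeqV (L : signature) (M : model L) S x y : x \in S -> y \in S ->
  flat_on S (NeqV x y : formula L) (fun s : assignment M => fnd s x <> fnd s y).
Proof.
move=> xS yS T TS /=; split=> [H s /H[a [b [-> -> ab]]] []//|H s Ts].
have := H s Ts; rewrite (in_fnd (TS s x Ts xS)) (in_fnd (TS s y Ts yS)) => neq.
by do 2!eexists; split=> // eq; apply: neq; rewrite eq.
Qed.

Lemma flat_And (L : signature) (M : model L) S (phi psi : formula L)
    (P Q : assignment M -> Prop) :
  flat_on S phi P -> flat_on S psi Q ->
  flat_on S (And phi psi) (fun s => P s /\ Q s).
Proof.
move=> fP fQ T TS /=; rewrite (fP _ TS) (fQ _ TS).
by split=> [[TP TQ] s Ts|TPQ]; [split; [exact: TP|exact: TQ]|split=> s /TPQ[]].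
Qed.

Lemma flat_Or (L : signature) (M : model L) S (phi psi : formula L)
    (P Q : assignment M -> Prop) :
  flat_on S phi P -> flat_on S psi Q ->
  flat_on S (Or phi psi) (fun s => P s \/ Q s).
Proof.
move=> fP fQ T TS /=; split=> [[U [V [TE]]]|TPQ].
  rewrite fP ?fQ; try by move=> s x ?; apply: TS; rewrite TE; (left + right).
  by move=> UP VQ s; rewrite TE => -[/UP|/VQ]; [left|right].
exists (T `&` P), (T `&` Q); split.
- by apply/seteqP; split=> s; [move=> Ts; have [] := TPQ s Ts; [left|right]|case=> -[]].
- by apply/fP => [s x [Ts _]|s []//]; exact: TS.
- by apply/fQ => [s x [Ts _]|s []//]; exact: TS.
Qed.

Lemma flat_iff (L : signature) (M : model L) S (phi : formula L)
    (P Q : assignment M -> Prop) :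
  (forall s, P s <-> Q s) -> flat_on S phi P -> flat_on S phi Q.
Proof.
move=> PQ fP T /fP ->; split=> H s Ts; apply/PQ; exact: H.
Qed.

(** Equality and inequality of the nonempty tuples [x :: xs] and [y :: ys] of
the same length; the heads are separate arguments because the empty conjunction
and disjunction are not formulas. *)
Fixpoint EqT (L : signature) (x y : var) (xs ys : seq var) : formula L :=
  match xs, ys with
  | x' :: xs', y' :: ys' => And (EqV x y) (EqT L x' y' xs' ys')
  | _, _ => EqV x y
  end.

Fixpoint NeqT (L : signature) (x y : var) (xs ys : seq var) : formula L :=
  match xs, ys with
  | x' :: xs', y' :: ys' => Or (NeqV x y) (NeqT L x' y' xs' ys')
  | _, _ => NeqV x y
  end.

Lemma flat_EqT (L : signature) (M : model L) S x y xs ys :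
  size xs = size ys -> {subset x :: xs <= S} -> {subset y :: ys <= S} ->
  flat_on S (EqT L x y xs ys)
    (fun s : assignment M => tuple_val s (x :: xs) = tuple_val s (y :: ys)).
Proof.
elim: xs ys x y => [|x' xs IH] [|y' ys] x y //= sz xsS ysS.
  apply: flat_iff (flat_EqV (xsS x _) (ysS y _)); rewrite ?inE ?eqxx // => s.
  by split=> [->|[]].
apply: flat_iff (flat_And (flat_EqV (xsS x _) (ysS y _)) (IH ys x' y' _ _ _)).
- by move=> s /=; split=> [[-> ->]|[-> -> ->]].
- by rewrite inE eqxx.
- by rewrite inE eqxx.
- by case: sz.
- by move=> z zxs; apply: xsS; rewrite inE zxs orbT.
- by move=> z zys; apply: ysS; rewrite inE zys orbT.
Qed.

Lemma flat_NeqT (L : signature) (M : model L) S x y xs ys :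
  size xs = size ys -> {subset x :: xs <= S} -> {subset y :: ys <= S} ->
  flat_on S (NeqT L x y xs ys)
    (fun s : assignment M => tuple_val s (x :: xs) <> tuple_val s (y :: ys)).
Proof.
elim: xs ys x y => [|x' xs IH] [|y' ys] x y //= sz xsS ysS.
  apply: flat_iff (flat_NeqV (xsS x _) (ysS y _)); rewrite ?inE ?eqxx // => s.
  by split=> [xy []//|xy eq]; apply: xy; rewrite eq.
apply: flat_iff (flat_Or (flat_NeqV (xsS x _) (ysS y _)) (IH ys x' y' _ _ _)).
- move=> s /=; split=> [[xy|xys] [e1 e2 e3]|neq]; first exact: xy.
    by apply: xys; rewrite e2 e3.
  have [e|] := pselect (fnd s x = fnd s y); last by left.
  by right=> -[e2 e3]; apply: neq; rewrite e e2 e3.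
- by rewrite inE eqxx.
- by rewrite inE eqxx.
- by case: sz.
- by move=> z zxs; apply: xsS; rewrite inE zxs orbT.
- by move=> z zys; apply: ysS; rewrite inE zys orbT.
Qed.

(** * Free variables and membership in extensions of first-order logic *)

Lemma free_vars_EqV (L : signature) x y (S : seq var) : x \in S -> y \in S ->
  free_vars (EqV x y : formula L) `<=` [set` S].
Proof. by move=> xS yS z [] ->. Qed.

Lemma free_vars_NeqV (L : signature) x y (S : seq var) : x \in S -> y \in S ->
  free_vars (NeqV x y : formula L) `<=` [set` S].
Proof. by move=> xS yS z [] ->. Qed.

Lemma free_vars_And (L : signature) (phi psi : formula L) (S : seq var) :
  free_vars phi `<=` [set` S] -> free_vars psi `<=` [set` S] ->
  free_vars (And phi psi) `<=` [set` S].
Proof. by rewrite /= subUset. Qed.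

Lemma free_vars_Or (L : signature) (phi psi : formula L) (S : seq var) :
  free_vars phi `<=` [set` S] -> free_vars psi `<=` [set` S] ->
  free_vars (Or phi psi) `<=` [set` S].
Proof. by rewrite /= subUset. Qed.

Lemma free_vars_Atm (L : signature) a (S : seq var) : {subset atom_vars a <= S} ->
  free_vars (Atm a : formula L) `<=` [set` S].
Proof. by []. Qed.

Lemma free_vars_Exs (L : signature) ws (phi : formula L) S :
  free_vars phi `<=` [set` ws ++ S] -> free_vars (Exs ws phi) `<=` [set` S].
Proof.
elim: ws S => [|w ws IH] S //= phiS v [vf /= vw].
have /IH/(_ v vf) : free_vars phi `<=` [set` ws ++ (w :: S)].
  move=> z /phiS; rewrite /= !(inE, mem_cat); case: eqP => //= _.
  by rewrite orbT.
by rewrite /= inE => /orP[/eqP|].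
Qed.

Lemma free_vars_Alls (L : signature) ws (phi : formula L) S :
  free_vars phi `<=` [set` ws ++ S] -> free_vars (Alls ws phi) `<=` [set` S].
Proof.
elim: ws S => [|w ws IH] S //= phiS v [vf /= vw].
have /IH/(_ v vf) : free_vars phi `<=` [set` ws ++ (w :: S)].
  move=> z /phiS; rewrite /= !(inE, mem_cat); case: eqP => //= _.
  by rewrite orbT.
by rewrite /= inE => /orP[/eqP|].
Qed.

Lemma in_FO_Exs (L : signature) P ws (phi : formula L) :
  in_FO P phi -> in_FO P (Exs ws phi).
Proof. by move=> ?; elim: ws. Qed.

Lemma in_FO_EqT (L : signature) P x y xs ys : in_FO P (EqT L x y xs ys).
Proof. by elim: xs ys x y => [|x' xs IH] [|y' ys] x y /=. Qed.

Lemma in_FO_NeqT (L : signature) P x y xs ys : in_FO P (NeqT L x y xs ys).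
Proof. by elim: xs ys x y => [|x' xs IH] [|y' ys] x y /=. Qed.

Lemma free_vars_EqT (L : signature) x y xs ys (S : seq var) :
  {subset x :: xs <= S} -> {subset y :: ys <= S} ->
  free_vars (EqT L x y xs ys) `<=` [set` S].
Proof.
elim: xs ys x y => [|x' xs IH] [|y' ys] x y xsS ysS;
  try by apply: free_vars_EqV; [apply: xsS|apply: ysS]; rewrite mem_head.
apply: free_vars_And.
  by apply: free_vars_EqV; [apply: xsS|apply: ysS]; rewrite mem_head.
by apply: IH => z zs; [apply: xsS|apply: ysS]; rewrite inE zs orbT.
Qed.

Lemma free_vars_NeqT (L : signature) x y xs ys (S : seq var) :
  {subset x :: xs <= S} -> {subset y :: ys <= S} ->
  free_vars (NeqT L x y xs ys) `<=` [set` S].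
Proof.
elim: xs ys x y => [|x' xs IH] [|y' ys] x y xsS ysS;
  try by apply: free_vars_NeqV; [apply: xsS|apply: ysS]; rewrite mem_head.
apply: free_vars_Or.
  by apply: free_vars_NeqV; [apply: xsS|apply: ysS]; rewrite mem_head.
by apply: IH => z zs; [apply: xsS|apply: ysS]; rewrite inE zs orbT.
Qed.

Lemma fresh_vars (S : seq var) n :
  exists ws : seq var, [/\ size ws = n, uniq ws & {in S, forall x, x \notin ws}].
Proof.
exists (iota (\max_(x <- S) x).+1 n); split; rewrite ?size_iota ?iota_uniq //.
move=> x xS; rewrite mem_iota negb_and -ltnNge ltnS.
by rewrite (big_rem x) //= leq_maxl.
Qed.

(** * Definability of atoms *)

(** On infinite models, [a] is equivalent to a formula of the extension of
first-order logic by the atoms in [P], with free variables among those of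
[a]. *)
Definition definable (L : signature) (P : pred atom) (a : atom) : Prop :=
  exists phi : formula L,
    [/\ in_FO P phi, free_vars phi `<=` [set` atom_vars a] &
        defines_on_infinite phi a].

Lemma definable_atom (L : signature) (P : pred atom) a : P a -> definable L P a.
Proof. by move=> Pa; exists (Atm a); split. Qed.

(** Definable atoms may be used in formulas: they can be replaced by their
definitions. *)
Lemma translate_definable (L : signature) (P : pred atom) (psi : formula L) :
  in_FO (fun b => `[< definable L P b >]) psi ->
  exists phi : formula L, [/\ in_FO P phi, free_vars phi `<=` free_vars psi &
    forall M : model L, infinite_set [set: M] ->
    forall (D : {fset var}) (T : set (assignment M)), team_on D T ->
    free_vars psi `<=` [set` D] -> sat T psi <-> sat T phi].
Proof.
elim: psi => [l|a|psi1 IH1 psi2 IH2|psi1 IH1 psi2 IH2|x psi IH|x psi IH] /=.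
- by move=> _; exists (Lit l); split.
- by move=> /asboolP[phi [Pphi fphi aphi]]; exists phi; split.
- move=> [/IH1[phi1 [P1 f1 e1]] /IH2[phi2 [P2 f2 e2]]].
  exists (And phi1 phi2); split=> //=; first exact: setUSS.
  move=> M Minf D T TD; rewrite subUset => -[D1 D2].
  by rewrite (e1 M Minf D T) // (e2 M Minf D T).
- move=> [/IH1[phi1 [P1 f1 e1]] /IH2[phi2 [P2 f2 e2]]].
  exists (Or phi1 phi2); split=> //=; first exact: setUSS.
  move=> M Minf D T TD; rewrite subUset => -[D1 D2].
  have TDsub U : U `<=` T -> team_on D U by move=> UT s /UT; exact: TD.
  by split=> -[U [V [TE TU TV]]]; exists U, V; split=> //;
    (apply/(e1 M Minf D) || apply/(e2 M Minf D)) => //; apply: TDsub;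
    rewrite TE => s Us; (left + right).
- move=> /IH[phi [Pphi fphi e]]; exists (Ex x phi); split=> //=; first exact: setSD.
  move=> M Minf D T TD fD.
  have eF F : sat (supplement T x F) psi <-> sat (supplement T x F) phi.
    apply: (e M Minf (x |` D)%fset) => [_ [s [a [/TD <- _ ->]]]//|v psiv].
    rewrite /= in_fset1U; have [//|/eqP vx] := eqVneq v x.
    by apply: fD; split.
  by split=> -[F [F0 /eF]]; exists F.
- move=> /IH[phi [Pphi fphi e]]; exists (All x phi); split=> //=; first exact: setSD.
  move=> M Minf D T TD fD.
  apply: (e M Minf (x |` D)%fset) => [_ [s [a [/TD <- _ ->]]]//|v psiv].
  rewrite /= in_fset1U; have [//|/eqP vx] := eqVneq v x.
  by apply: fD; split.
Qed.

Lemma definable_by (L : signature) (P : pred atom) (psi : formula L) a :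
  in_FO (fun b => `[< definable L P b >]) psi ->
  free_vars psi `<=` [set` atom_vars a] ->
  (forall M : model L, infinite_set [set: M] ->
     forall T : set (assignment M), defined_on (atom_vars a) T ->
     atom_holds T a <-> sat T psi) ->
  definable L P a.
Proof.
move=> /translate_definable[phi [Pphi fphi e]] fpsi apsi.
exists phi; split=> //; first exact: subset_trans fphi fpsi.
move=> M Minf D T TD aD; rewrite -(e M Minf D) //; last exact: subset_trans fpsi aD.
by apply: apsi => // s x /TD -> /aD.
Qed.

(** * Coding a tuple by one variable *)

(** If [a'] has the same meaning as [a] on all teams where equality of [xs] and
equality of [p] are equivalent, then [a] is definable from [a']: existentially
quantify [p] and say, by dependence atoms, that it codes [xs]. *)
Lemma definable_code (L : signature) (P : pred atom) a xs p a' :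
  p \notin atom_vars a -> {subset xs <= atom_vars a} ->
  {subset atom_vars a' <= p :: atom_vars a} ->
  definable L P (Dep xs p) -> (forall x, x \in xs -> definable L P (Dep [:: p] x)) ->
  definable L P a' ->
  (forall (M : Type) (T : set (assignment M)),
     (forall s s', T s -> T s' ->
        tuple_val s xs = tuple_val s' xs <-> fnd s p = fnd s' p) ->
     atom_holds T a <-> atom_holds T a') ->
  definable L P a.
Proof.
move=> pa xsa a'a dxs dp da' aa'.
pose deps ys : formula L :=
  foldr (fun x phi => And (Atm (Dep [:: p] x)) phi) (Atm a') ys.
have in_deps ys : {subset ys <= xs} ->
    in_FO (fun b => `[< definable L P b >]) (deps ys).
  elim: ys => [|y ys IH] ysxs /=; first exact/asboolP.
  split; first by apply/asboolP/dp/ysxs; rewrite mem_head.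
  by apply: IH => z zys; apply: ysxs; rewrite inE zys orbT.
have fv_deps ys : {subset ys <= xs} -> free_vars (deps ys) `<=` [set` p :: atom_vars a].
  elim: ys => [|y ys IH] ysxs /=; first by move=> v; exact: a'a.
  rewrite subUset; split.
    move=> v /=; rewrite !inE => /orP[->//|/eqP->]; rewrite xsa ?orbT //.
    by apply: ysxs; rewrite mem_head.
  by apply: IH => z zys; apply: ysxs; rewrite inE zys orbT.
have sat_deps (M : model L) (T : set (assignment M)) ys :
    sat T (deps ys) <->
    (forall y, y \in ys -> atom_holds T (Dep [:: p] y)) /\ atom_holds T a'.
  elim: ys => [|y ys IH] /=; first by split=> // -[].
  rewrite IH; split=> [[Ty [Tys Ta']]|[Tys Ta']].
    by split=> // z; rewrite inE => /orP[/eqP->|/Tys].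
  split; first by apply: Tys; rewrite mem_head.
  by split=> // z zys; apply: Tys; rewrite inE zys orbT.
apply: (@definable_by L P (Exs [:: p] (And (Atm (Dep xs p)) (deps xs)))).
- by split; [exact/asboolP|exact: in_deps].
- apply: free_vars_Exs; rewrite /= subUset; split; last exact: fv_deps.
  move=> v /=; rewrite mem_rcons !inE => /orP[->//|/xsa ->]; by rewrite orbT.
move=> M Minf T Ta.
have aNp : {in atom_vars a, forall x, x \notin [:: p]}.
  by move=> x xa; rewrite inE; apply: contraNneq pa => <-.
have xsNp : {in xs, forall x, x \notin [:: p]} by move=> x /xsa/aNp.
split.
- move=> Ha; have [c cinj] := tuple_code Minf.
  pose Phi := [set s : assignment M |
    forall t, tuple_val s xs = map some t -> fnd s p = Some (c t)].
  have TT' : variation [:: p] T (restricted_variation [:: p] T Phi).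
    apply: variation_restricted => s Ts.
    have [t st] := tuple_val_some Ta Ts xsa.
    have [s' ss' [s'p]] := @variant_tuple_exists M [:: p] s [:: c t] isT erefl.
    exists s' => // t'; rewrite (variant_tuple ss' xsNp) st.
    by move=> /(inj_map (@Some_inj _)) <-.
  apply/sat_Exs; exists (restricted_variation [:: p] T Phi) => //.
  set T' := restricted_variation _ _ _ in TT' *.
  have T'xs s : T' s -> exists t, tuple_val s xs = map some t /\ fnd s p = Some (c t).
    move=> [Phis [r Tr rs]]; have [t rt] := tuple_val_some Ta Tr xsa.
    have st : tuple_val s xs = map some t by rewrite (variant_tuple rs xsNp).
    by exists t; rewrite (Phis t st).
  have kernel s s' : T' s -> T' s' ->
      tuple_val s xs = tuple_val s' xs <-> fnd s p = fnd s' p.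
    move=> /T'xs[t [st ->]] /T'xs[t' [st' ->]].
    rewrite st st'; split=> [/(inj_map (@Some_inj _)) -> //|[]].
    have sz : size t = size t'.
      by rewrite -(size_map some t) -(size_map some t') -st -st' !size_map.
    by move=> /(cinj _ _ sz) ->.
  split; first by move=> s s' T's T's' /(kernel _ _ T's T's').
  apply/sat_deps; split; last by rewrite -aa' // -(atom_holds_variation TT').
  move=> y yxs s s' T's T's' [] /(kernel _ _ T's T's').
  by move=> /eq_in_map/(_ y yxs).
- move=> /sat_Exs[T' TT' [/= dxp /sat_deps[dpx Ta']]].
  rewrite (atom_holds_variation TT') // aa' // => s s' T's T's'.
  split; first exact: dxp.
  by move=> spp; apply/eq_in_map => y yxs; apply: dpx => //=; rewrite spp.
Qed.

(** * Dependence atoms *)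

(** Short tuples are special cases: [=(x, y)] repeats [x], and [=(, y)] is
[forall u, =(u, y)], since any two assignments can be given the same value for
[u]. *)
Lemma definable_dep (L : signature) (P : pred atom) :
  (forall x y z, definable L P (Dep [:: x; y] z)) ->
  forall xs y, definable L P (Dep xs y).
Proof.
move=> d2.
have d1 x y : definable L P (Dep [:: x] y).
  apply: (@definable_by L P (Atm (Dep [:: x; x] y))); first exact/asboolP.
    by move=> v /=; rewrite !inE => /or3P[]->; rewrite ?orbT.
  by move=> M _ T _ /=; split=> H s s' Ts Ts' => [[sx _]|[sx]];
    apply: H => //=; rewrite sx.
have d0 y : definable L P (Dep [::] y).
  have [ws [sz _ /(_ y (mem_head _ _))]] := fresh_vars [:: y] 1.
  case: ws sz => [|u [|//]] //= _; rewrite inE => yu.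
  apply: (@definable_by L P (Alls [:: u] (Atm (Dep [:: u] y)))); first exact/asboolP.
    by apply: free_vars_Alls => v /=; rewrite !inE.
  move=> M Minf T Ty; rewrite sat_Alls /=; split=> [H|H s s' Ts Ts' _].
    move=> r r' [s Ts [_ rs]] [s' Ts' [_ rs']] _.
    by rewrite rs ?rs' ?inE //; apply: H.
  have [d _] := infinite_setN0 Minf.
  have [r sr [ru]] := @variant_tuple_exists M [:: u] s [:: d] isT erefl.
  have [r' sr' [ru']] := @variant_tuple_exists M [:: u] s' [:: d] isT erefl.
  have := H r r'; rewrite /= ru ru' sr.2 ?sr'.2 ?inE //.
  by apply=> //; [exists s|exists s'].
move=> xs; move: {2}(size xs) (leqnn (size xs)) => n.
elim: n xs => [|n IH] [|x1 [|x2 [|x3 xs]]] //= sz y.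
have [ws [wsz _ wsP]] := fresh_vars [:: x1, x2, x3 & rcons xs y] 1.
case: ws wsz wsP => [|p [|//]] //= _ pP.
apply: (@definable_code L P _ [:: x1; x2] p (Dep [:: p, x3 & xs] y)) => //=.
- by apply: contraT => /negPn /pP; rewrite mem_head.
- by move=> x; rewrite !inE => /orP[]->; rewrite ?orbT.
- by move=> x; rewrite !(inE, mem_rcons) => /or4P[]->; rewrite ?orbT.
- exact: IH.
move=> M T kernel; split=> H s s' Ts Ts' /= [].
  move=> /(kernel _ _ Ts Ts')[s1 s2] s3 st; apply: H => //=.
  by rewrite s1 s2 s3 st.
move=> s1 s2 s3 st; apply: H => //=; rewrite s3 st.
have /kernel -> // : tuple_val s [:: x1; x2] = tuple_val s' [:: x1; x2].
by rewrite /= s1 s2.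
Qed.

Lemma definable_indep3_dep2 (L : signature) (P : pred atom) :
  (forall x y z u v w, definable L P (Indep [:: x; y; z] [::] [:: u; v; w])) ->
  forall x y z, definable L P (Dep [:: x; y] z).
Proof.
move=> d3 x y z.
have [ws [sz uniq_ws wsP]] := fresh_vars [:: x; y; z] 3.
case: ws sz uniq_ws wsP => [|u [|u' [|v [|//]]]] //= _ uniq_ws wsP.
have [uu' uv u'v] : [/\ u != u', u != v & u' != v].
  by move: uniq_ws; rewrite !inE negb_or => /andP[/andP[-> ->] /andP[->]].
have xyzP : {in [:: x; y; z], forall t, t \notin [:: u; u'; v]} by [].
have xyzuP : {in [:: x; y; z], forall t, t \notin [:: u; u']}.
  by move=> t /wsP; rewrite !inE !negb_or => /and3P[-> ->].
have xyzvP : {in [:: x; y; z], forall t, t \notin [:: v]}.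
  by move=> t /wsP; rewrite !inE !negb_or => /and3P[_ _ ->].
have uvP : {in [:: u; u'], forall t, t \notin [:: v]}.
  by move=> t; rewrite !inE => /orP[]/eqP->.
pose ind := Indep [:: u; u'; v] [::] [:: x; y; z].
pose mat : formula L := Or (Or (NeqV u x) (NeqV u' y)) (EqV v z).
have flat_mat (M : model L) : flat_on [:: u, u', v & [:: x; y; z]] mat
    (fun s : assignment M =>
       (fnd s u <> fnd s x \/ fnd s u' <> fnd s y) \/ fnd s v = fnd s z).
  by apply: flat_Or; [apply: flat_Or; apply: flat_NeqV|apply: flat_EqV];
     rewrite !inE eqxx ?orbT.
apply: (@definable_by L P (Alls [:: u; u'] (Exs [:: v] (And (Atm ind) mat)))).
- by split=> //=; exact/asboolP/d3.
- apply/free_vars_Alls/free_vars_Exs/free_vars_And.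
    by apply/free_vars_Atm/allP; rewrite /= !inE !eqxx ?orbT.
  by apply: free_vars_Or;
     [apply: free_vars_Or; apply: free_vars_NeqV|apply: free_vars_EqV];
     rewrite !inE !eqxx ?orbT.
move=> M Minf T Txyz.
split=> [H|/sat_AllsExs_elim[T' [[/= indT' matT'] T'T TT']] s r Ts Tr /= [srx sry]].
- have [d _] := infinite_setN0 Minf.
  (* [f] is the function from [x y] to [z] given by the team, extended by the
     default value [d]; the rows of the new team have [v = f (u, u')]. *)
  have /choice[f fP] (ab : M * M) : exists c, forall s, T s ->
      fnd s x = Some (fst ab) -> fnd s y = Some (snd ab) -> fnd s z = Some c.
    have [[s [Ts sx sy]]|nex] := pselect (exists s, [/\ T s, fnd s x = Some (fst ab) &
        fnd s y = Some (snd ab)]).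
      have [|c sc] := fnd_some (x := z) Txyz Ts; first by rewrite !inE eqxx !orbT.
      exists c => r Tr rx ry; rewrite -sc; apply: H => //=.
      by rewrite sx sy rx ry.
    by exists d => s Ts sx sy; case: nex; exists s.
  pose Phi := [set s : assignment M | forall a b,
     fnd s u = Some a -> fnd s u' = Some b -> fnd s v = Some (f (a, b))].
  have Tuu (s s1 : assignment M) : variant [:: u; u'] s s1 ->
      exists a b, fnd s1 u = Some a /\ fnd s1 u' = Some b.
    move=> [ds1 _].
    have [us u's] : u \in domf s1 /\ u' \in domf s1 by rewrite ds1 !inE !eqxx !orbT.
    by rewrite (in_fnd us) (in_fnd u's); do 2!eexists.
  have ext (s1 : assignment M) a b : fnd s1 u = Some a -> fnd s1 u' = Some b ->
      exists2 s', variant [:: v] s1 s' & Phi s'.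
    move=> s1u s1u'.
    have [s' s1s' [s'v]] := @variant_tuple_exists M [:: v] s1 [:: f (a, b)] isT erefl.
    exists s' => // a' b'; rewrite (s1s'.2 u) ?(s1s'.2 u') ?uvP ?inE ?eqxx ?orbT //.
    by rewrite s1u s1u' => -[<-] [<-].
  apply: (@sat_AllsExs_intro _ _ _ _ _ Phi).
    by move=> s s1 Ts /Tuu[a [b [s1u s1u']]]; exact: ext _ _ _ s1u s1u'.
  set T' := restricted_variation _ _ _.
  have T'T s' : T' s' -> exists2 s, T s & variant [:: u; u'; v] s s' by case.
  split.
    move=> s' r' T's' /T'T[r Tr rr'] _.
    have [a [b [s'u s'u']]] : exists a b, fnd s' u = Some a /\ fnd s' u' = Some b.
      have := defined_on_variant Txyz T'T => T'def.
      have [|a s'a] := fnd_some (x := u) T'def T's'; first by rewrite !inE eqxx.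
      have [|b s'b] := fnd_some (x := u') T'def T's'; first by rewrite !inE eqxx orbT.
      by exists a, b.
    have [q1 rq1 [q1u q1u']] : exists2 q1, variant [:: u; u'] r q1 &
        tuple_val q1 [:: u; u'] = map some [:: a; b].
      by apply: variant_tuple_exists; rewrite //= inE uu'.
    have [q q1q Phiq] := ext _ _ _ q1u q1u'.
    exists q; split=> //.
    + by split=> //; exists r => //; apply/(variant_cat [:: u; u']); exists q1.
    + have [Phis' _] := T's'.
      have qu : fnd q u = Some a by rewrite q1q.2 ?uvP ?mem_head.
      have qu' : fnd q u' = Some b by rewrite q1q.2 ?uvP // !inE eqxx orbT.
      by rewrite /= qu qu' s'u s'u' (Phiq _ _ qu qu') (Phis' _ _ s'u s'u').
    + by rewrite (variant_tuple q1q) // (variant_tuple rq1) // (variant_tuple rr').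
  apply/flat_mat; first exact: defined_on_variant Txyz T'T.
  move=> s' [Phis' [s Ts ss']].
  have [[e1 e2]|] := pselect (fnd s' u = fnd s' x /\ fnd s' u' = fnd s' y); last first.
    by move=> /not_andP[]; left; [left|right].
  right; have [sx sy sz] :
      [/\ fnd s' x = fnd s x, fnd s' y = fnd s y & fnd s' z = fnd s z].
    by split; apply: ss'.2; apply: xyzP; rewrite !inE eqxx ?orbT.
  have [|a sa] := fnd_some (x := x) Txyz Ts; first by rewrite !inE eqxx.
  have [|b sb] := fnd_some (x := y) Txyz Ts; first by rewrite !inE eqxx orbT.
  rewrite sz (Phis' a b) ?e1 ?e2 ?sx ?sy //; exact/esym/fP.
- have T'def := defined_on_variant Txyz T'T.
  have {}matT' := (proj1 (flat_mat _ _ T'def)) matT'.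
  have [|a sa] := fnd_some (x := x) Txyz Ts; first by rewrite !inE eqxx.
  have [|b sb] := fnd_some (x := y) Txyz Ts; first by rewrite !inE eqxx orbT.
  have ext q : T q -> fnd q x = Some a -> fnd q y = Some b ->
      exists s', [/\ T' s', fnd s' u = Some a, fnd s' u' = Some b &
        tuple_val s' [:: x; y; z] = tuple_val q [:: x; y; z]].
    move=> Tq qx qy.
    have [q1 qq1 [q1u q1u']] : exists2 q1, variant [:: u; u'] q q1 &
        tuple_val q1 [:: u; u'] = map some [:: a; b].
      by apply: variant_tuple_exists; rewrite //= inE uu'.
    have [q' T'q' q1q'] := TT' _ _ Tq qq1; exists q'.
    split=> //; rewrite ?(variant_tuple q1q') // ?(variant_tuple qq1) //.
      by rewrite q1q'.2 ?uvP ?mem_head.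
    by rewrite q1q'.2 ?uvP // !inE eqxx orbT.
  (* [q'] combines the values of [u u' v] in [s'] with those of [x y z] in [r'],
     so the matrix forces the same [v] to be equal to both values of [z]. *)
  have [s' [T's' s'u s'u' [s'x s'y s'z]]] := ext s Ts sa sb.
  have [||r' [T'r' r'u r'u' [r'x r'y r'z]]] := ext r Tr; rewrite -?srx -?sry //.
  have [q' [T'q' _ [q'u q'u' q'v] [q'x q'y q'z]]] := indT' _ _ T's' T'r' erefl.
  have mat1 : fnd s' v = fnd s' z.
    by case: (matT' _ T's') => // -[]; rewrite ?s'u ?s'u' ?s'x ?s'y ?sa ?sb.
  have mat2 : fnd q' v = fnd q' z.
    case: (matT' _ T'q') => // -[]; rewrite ?q'u ?q'u' ?q'x ?q'y ?r'x ?r'y ?s'u ?s'u'.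
      by rewrite -srx sa.
    by rewrite -sry sb.
  by rewrite -s'z -r'z -mat1 -q'v mat2.
Qed.

(** * Pure independence, inclusion, anonymity and exclusion *)

(** An independence atom is definable as soon as it is after replacing one of its
three tuples by a single variable. *)
Lemma definable_indep_code (L : signature) (P : pred atom) xs zs ys :
  (forall vs v, definable L P (Dep vs v)) ->
  (forall p, definable L P (Indep [:: p] zs ys)) \/
  (forall p, definable L P (Indep xs [:: p] ys)) \/
  (forall p, definable L P (Indep xs zs [:: p])) ->
  definable L P (Indep xs zs ys).
Proof.
move=> dep; have [ws [sz _ wsP]] := fresh_vars (atom_vars (Indep xs zs ys)) 1.
case: ws sz wsP => [|p [|//]] //= _ wsP.
have pP : p \notin xs ++ zs ++ ys by apply: contraT => /negPn /wsP; rewrite mem_head.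
case=> [|[]] /(_ p).
- move=> dp; apply: (@definable_code L P _ xs p (Indep [:: p] zs ys)) => //=.
  + by move=> x xxs; rewrite mem_cat xxs.
  + by move=> x; rewrite !(inE, mem_cat) => /or3P[]->; rewrite ?orbT.
  move=> M T kernel; split=> H s s' Ts Ts' zss'; have [q [Tq qz qx qy]] := H _ _ Ts Ts' zss'.
    by exists q; split=> //=; move/(kernel _ _ Tq Ts): qx => ->.
  by exists q; split=> //; apply/(kernel _ _ Tq Ts); case: qx.
- move=> dp; apply: (@definable_code L P _ zs p (Indep xs [:: p] ys)) => //=.
  + by move=> x xzs; rewrite !mem_cat xzs orbT.
  + by move=> x; rewrite !(inE, mem_cat) => /or3P[]->; rewrite ?orbT.
  move=> M T kernel; split=> H s s' Ts Ts'.
    move=> -[/(kernel _ _ Ts Ts') zss']; have [q [Tq qz qx qy]] := H _ _ Ts Ts' zss'.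
    by exists q; split=> //=; move/(kernel _ _ Tq Ts): qz => ->.
  move=> /(kernel _ _ Ts Ts') zss'.
  have [|q [Tq [qz] qx qy]] := H _ _ Ts Ts'; first by rewrite /= zss'.
  by exists q; split=> //; apply/(kernel _ _ Tq Ts).
- move=> dp; apply: (@definable_code L P _ ys p (Indep xs zs [:: p])) => //=.
  + by move=> x xys; rewrite !mem_cat xys !orbT.
  + by move=> x; rewrite !(inE, mem_cat) => /or3P[]->; rewrite ?orbT.
  move=> M T kernel; split=> H s s' Ts Ts' zss'; have [q [Tq qz qx qy]] := H _ _ Ts Ts' zss'.
    by exists q; split=> //=; move/(kernel _ _ Tq Ts'): qy => ->.
  by exists q; split=> //; apply/(kernel _ _ Tq Ts'); case: qy.
Qed.

Lemma definable_pure_indep (L : signature) (P : pred atom) :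
  (forall x y z u v w, definable L P (Indep [:: x; y; z] [::] [:: u; v; w])) ->
  forall xs ys, definable L P (Indep xs [::] ys).
Proof.
move=> d3 xs ys; have dep := definable_dep (definable_indep3_dep2 d3).
apply: (definable_indep_code (dep)); left=> p.
apply: (definable_indep_code (dep)); right; right=> q.
apply: (@definable_by L P (Atm (Indep [:: p; p; p] [::] [:: q; q; q]))).
- exact/asboolP/d3.
- by apply/free_vars_Atm/allP; rewrite /= !inE !eqxx ?orbT.
move=> M _ T _; split=> H s s' Ts Ts' _.
  by have [r [Tr _ [rp] [rq]]] := H _ _ Ts Ts' erefl; exists r; rewrite /= rp rq.
by have [r [Tr _ [rp _ _] [rq _ _]]] := H _ _ Ts Ts' erefl; exists r; rewrite /= rp rq.
Qed.

Lemma definable_incl (L : signature) (P : pred atom) :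
  (forall xs ys, definable L P (Indep xs [::] ys)) ->
  forall xs ys, 0 < size xs -> size xs = size ys -> definable L P (Incl xs ys).
Proof.
move=> pure [//|x xs] [//|y ys] _ [sxy].
have [ws [sz uniq_ws wsP]] := fresh_vars ((x :: xs) ++ y :: ys) (size xs).+4.
case: ws sz uniq_ws wsP => [|v1 [|v2 [|v3 [|w ws]]]] // [sws] uniq_ws wsP.
have [uniq_v uniq_w vwP] : [/\ uniq [:: v1; v2; v3], uniq (w :: ws) &
    {in [:: v1; v2; v3], forall z, z \notin w :: ws}].
  move: uniq_ws; rewrite (cat_uniq [:: v1; v2; v3]) => /and3P[-> /hasPn H ->].
  by split=> // z zv; apply: contraL zv => /H.
have mem_vw z : (z \in [:: v1, v2, v3, w & ws]) =
    (z \in [:: v1; v2; v3]) || (z \in w :: ws).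
  exact: (mem_cat z [:: v1; v2; v3]).
have fresh_v : {in (x :: xs) ++ y :: ys, forall z, z \notin [:: v1; v2; v3]}.
  move=> z /wsP; apply: contra; by rewrite mem_vw => ->.
have fresh_w : {in (x :: xs) ++ y :: ys, forall z, z \notin w :: ws}.
  by move=> z /wsP; apply: contra => zw; rewrite mem_vw zw orbT.
have xsP : {subset x :: xs <= (x :: xs) ++ y :: ys}.
  by move=> z zxs; rewrite mem_cat zxs.
have ysP : {subset y :: ys <= (x :: xs) ++ y :: ys}.
  by move=> z zys; rewrite mem_cat zys orbT.
have fvx z zxs := fresh_v z (xsP z zxs). have fvy z zys := fresh_v z (ysP z zys).
have fwx z zxs := fresh_w z (xsP z zxs). have fwy z zys := fresh_w z (ysP z zys).
set S := [:: v1, v2, v3, w & ws] ++ (x :: xs) ++ y :: ys.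
have xsS : {subset x :: xs <= S} by move=> z /xsP zz; rewrite mem_cat zz orbT.
have ysS : {subset y :: ys <= S} by move=> z /ysP zz; rewrite mem_cat zz orbT.
have wsS : {subset w :: ws <= S}.
  by move=> z zw; rewrite mem_cat mem_vw zw orbT.
have [v1S v2S v3S] : [/\ v1 \in S, v2 \in S & v3 \in S].
  by rewrite /S !inE !eqxx !orbT.
pose mat : formula L :=
  Or (And (EqV v1 v2) (And (EqV v2 v3) (EqT L w x ws xs)))
     (And (Or (NeqV v1 v2) (NeqV v2 v3)) (EqT L w y ws ys)).
pose Phi (M : Type) := [set s : assignment M |
  (fnd s v1 = fnd s v2 /\ fnd s v2 = fnd s v3 /\
     tuple_val s (w :: ws) = tuple_val s (x :: xs)) \/
  ((fnd s v1 <> fnd s v2 \/ fnd s v2 <> fnd s v3) /\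
     tuple_val s (w :: ws) = tuple_val s (y :: ys))].
have flat_mat (M : model L) : flat_on S mat (Phi M).
  apply: flat_Or; apply: flat_And.
  - exact: flat_EqV.
  - by apply: flat_And; [exact: flat_EqV|apply: flat_EqT => //; rewrite sws].
  - by apply: flat_Or; exact: flat_NeqV.
  - by apply: flat_EqT => //; rewrite sws.
pose ind := Indep (w :: ws) [::] [:: v1; v2].
apply: (@definable_by L P (Alls [:: v1; v2; v3] (Exs (w :: ws) (And (Atm ind) mat)))).
- apply: in_FO_Exs; split; first exact/asboolP/pure.
  by do !split; exact: in_FO_EqT.
- apply/free_vars_Alls/free_vars_Exs.
  pose S' := (w :: ws) ++ [:: v1; v2; v3] ++ (x :: xs) ++ y :: ys.
  have SS' : {subset S <= S'}.
    by move=> z; rewrite /S /S' !(inE, mem_cat); do !case/orP; move=> ->; rewrite ?orbT.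
  have sub (phi : formula L) :
      free_vars phi `<=` [set` S] -> free_vars phi `<=` [set` S'].
    by move=> phiS z /phiS; exact: SS'.
  apply: (sub (And (Atm ind) mat)); apply: free_vars_And.
    apply/free_vars_Atm => z; rewrite /= !(inE, mem_cat).
    by do !case/orP; move=> ->; rewrite ?orbT.
  apply: free_vars_Or; apply: free_vars_And.
  + exact: free_vars_EqV.
  + by apply: free_vars_And; [exact: free_vars_EqV|exact: free_vars_EqT].
  + by apply: free_vars_Or; exact: free_vars_NeqV.
  + exact: free_vars_EqT.
move=> M Minf T Txy.
have def_xs s : T s ->
    exists2 t, tuple_val s (x :: xs) = map some t & size t = size (w :: ws).
  move=> Ts; have [t st] := tuple_val_some Txy Ts xsP; exists t => //.
  by rewrite -(size_map some t) -st size_map /= sws.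
have def_ys s : T s ->
    exists2 t, tuple_val s (y :: ys) = map some t & size t = size (w :: ws).
  move=> Ts; have [t st] := tuple_val_some Txy Ts ysP; exists t => //.
  by rewrite -(size_map some t) -st size_map /= sws sxy.
have ext_v (s : assignment M) a b c : exists2 s1, variant [:: v1; v2; v3] s s1 &
    tuple_val s1 [:: v1; v2; v3] = map some [:: a; b; c].
  exact: variant_tuple_exists.
split=> [H|/sat_AllsExs_elim[T' [[indT' matT'] T'T TT']] s Ts].
- have ext (s s1 : assignment M) : T s -> variant [:: v1; v2; v3] s s1 ->
      exists2 s', variant (w :: ws) s1 s' & Phi M s'.
    move=> Ts ss1.
    have [[v12 v23]|nv] := pselect (fnd s1 v1 = fnd s1 v2 /\ fnd s1 v2 = fnd s1 v3).
      have [t st szt] := def_xs s Ts.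
      have [s' s1s' s't] := variant_tuple_exists s1 uniq_w szt.
      exists s' => //; left; rewrite !s1s'.2 ?vwP ?inE ?eqxx ?orbT // s't.
      by rewrite (variant_tuple s1s' fwx) (variant_tuple ss1 fvx).
    have [t st szt] := def_ys s Ts.
    have [s' s1s' s't] := variant_tuple_exists s1 uniq_w szt.
    exists s' => //; right; rewrite !s1s'.2 ?vwP ?inE ?eqxx ?orbT // s't.
    rewrite (variant_tuple s1s' fwy) (variant_tuple ss1 fvy); split=> //.
    exact/not_andP.
  apply: (sat_AllsExs_intro ext).
  have T'T s' : restricted_variation ([:: v1; v2; v3] ++ w :: ws) T (Phi M) s' ->
    exists2 s, T s & variant ([:: v1; v2; v3] ++ w :: ws) s s' by case.
  have T'def := defined_on_variant Txy T'T.
  split; last by apply/flat_mat => [|s []].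
  move=> s' r' [Phis' [s Ts ss']] T'r' _.
  have [|[//|a [//|b []//]] r'v] := tuple_val_some (xs := [:: v1; v2]) T'def T'r'.
    by apply/allP; rewrite /= !inE !eqxx !orbT.
  have [q0 Tq0 q0y] :
      exists2 q0, T q0 & tuple_val q0 (y :: ys) = tuple_val s' (w :: ws).
    have sx : tuple_val s' (x :: xs) = tuple_val s (x :: xs).
      apply: variant_tuple ss' _ => z zxs; rewrite mem_cat negb_or.
      by rewrite fvx // fwx.
    have sy : tuple_val s' (y :: ys) = tuple_val s (y :: ys).
      apply: variant_tuple ss' _ => z zys; rewrite mem_cat negb_or.
      by rewrite fvy // fwy.
    case: Phis' => [[_ [_ ->]]|[_ ->]]; last by exists s.
    by rewrite sx; have [q Tq qy] := H s Ts; exists q.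
  (* With [v3] different from [v2], the row for [q0] may take [ws = ys]. *)
  have [c cb] := infinite_neq b Minf.
  have [q1 q0q1 [q1v1 q1v2 q1v3]] := ext_v q0 a b c.
  have [t q0t szt] := def_ys q0 Tq0.
  have [q q1q qt] := variant_tuple_exists q1 uniq_w szt.
  have [qv1 qv2 qv3] : [/\ fnd q v1 = Some a, fnd q v2 = Some b & fnd q v3 = Some c].
    by rewrite !q1q.2 ?vwP ?inE ?eqxx ?orbT.
  exists q; split=> //.
  + split; last first.
      by exists q0 => //; apply/variant_cat; exists q1.
    right; rewrite qt (variant_tuple q1q fwy) (variant_tuple q0q1 fvy); split=> //.
    by right; rewrite qv2 qv3 => -[/esym].
  + by rewrite qt -q0t.
  + by rewrite r'v /= qv1 qv2.
- have T'def := defined_on_variant Txy T'T.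
  have {}matT' : forall s, T' s -> Phi M s.
    exact/flat_mat.
  have [a _] := infinite_setN0 Minf; have [b ba] := infinite_neq a Minf.
  (* Rows with [v1 = v2 = v3] show the value of [xs] as [ws]; independence moves
     it to a row with [v1 <> v2], where [ws = ys]. *)
  have [s1 ss1 [s1v1 s1v2 s1v3]] := ext_v s a a a.
  have [r1 sr1 [r1v1 r1v2 r1v3]] := ext_v s a b a.
  have [s' T's' s1s'] := TT' _ _ Ts ss1.
  have [r' T'r' r1r'] := TT' _ _ Ts sr1.
  have [q [T'q _ qw [qv1 qv2]]] := indT' _ _ T's' T'r' erefl.
  have s'w : tuple_val s' (w :: ws) = tuple_val s (x :: xs).
    case: (matT' _ T's') => [[_ [_ ->]]|[]].
      by rewrite (variant_tuple s1s' fwx) (variant_tuple ss1 fvx).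
    by rewrite !s1s'.2 ?vwP ?inE ?eqxx ?orbT // s1v1 s1v2 s1v3 => -[].
  have qw' : tuple_val q (w :: ws) = tuple_val q (y :: ys).
    case: (matT' _ T'q) => [[]|[]//].
    by rewrite qv1 qv2 !r1r'.2 ?vwP ?inE ?eqxx ?orbT // r1v1 r1v2 => -[/esym].
  have [r Tr rq] := T'T _ T'q; exists r => //.
  rewrite -s'w -qw qw'; apply: variant_tuple rq _ => z zys.
  by rewrite mem_cat negb_or fvy // fwy.
Qed.

Lemma tuple_val_rcons (M : Type) (s : assignment M) xs x :
  tuple_val s (rcons xs x) = rcons (tuple_val s xs) (fnd s x).
Proof. exact: map_rcons. Qed.

Lemma definable_anon (L : signature) (P : pred atom) :
  (forall xs ys, 0 < size xs -> size xs = size ys -> definable L P (Incl xs ys)) ->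
  forall xs y, definable L P (Anon xs y).
Proof.
move=> incl xs y.
have [ws [sz _ wsP]] := fresh_vars (rcons xs y) 1.
case: ws sz wsP => [|y' [|//]] //= _ wsP.
have yP : y \in rcons xs y by rewrite mem_rcons mem_head.
have xsP : {in xs, forall x, x \notin [:: y']}.
  by move=> x xxs; apply: wsP; rewrite mem_rcons inE xxs orbT.
pose inc := Incl (rcons xs y') (rcons xs y).
apply: (@definable_by L P (Exs [:: y'] (And (NeqV y' y) (Atm inc)))).
- by split=> //=; apply/asboolP/incl; rewrite ?size_rcons.
- apply: free_vars_Exs; apply: free_vars_And.
    by apply: free_vars_NeqV; rewrite inE ?eqxx // yP orbT.
  apply: free_vars_Atm => v; rewrite /= !(mem_cat, mem_rcons, inE).
  by do !case/orP; move=> ->; rewrite ?orbT.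
move=> M Minf T Txy.
have flat_mat : flat_on (y' :: rcons xs y) (NeqV y' y : formula L)
    (fun s : assignment M => fnd s y' <> fnd s y).
  by apply: flat_NeqV; rewrite inE ?eqxx // yP orbT.
split=> [H|/sat_Exs[T' [T'T TT'] [neqT' incT']] s Ts].
- pose Phi := [set s' : assignment M | fnd s' y' <> fnd s' y /\
    exists2 r, T r & rcons (tuple_val s' xs) (fnd s' y') = tuple_val r (rcons xs y)].
  have TT' : variation [:: y'] T (restricted_variation [:: y'] T Phi).
    apply: variation_restricted => s Ts; have [r [Tr srx sry]] := H s Ts.
    have [a ra] := fnd_some Txy Tr yP.
    have [s' ss' [s'y']] := @variant_tuple_exists M [:: y'] s [:: a] isT erefl.
    exists s' => //; split; first by rewrite s'y' -ra ss'.2 ?wsP // => /esym.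
    by exists r => //; rewrite (variant_tuple ss') // s'y' -ra srx tuple_val_rcons.
  apply/sat_Exs; exists (restricted_variation [:: y'] T Phi) => //.
  split; first by apply/flat_mat => [|s [[]]//]; exact: defined_on_variant Txy TT'.1.
  move=> s' [[_ [r Tr rE]] _]; have [r' T'r' rr'] := TT'.2 r Tr.
  by exists r' => //; rewrite tuple_val_rcons rE (variant_tuple rr').
- have [s' T's' ss'] := TT' s Ts; have [r' T'r'] := incT' s' T's'.
  rewrite !tuple_val_rcons => /rcons_inj[s'r'x s'r'y].
  have [r Tr rr'] := T'T r' T'r'; exists r; split=> //.
    by rewrite -(variant_tuple ss') // -(variant_tuple rr').
  have := (proj1 (flat_mat _ (defined_on_variant Txy T'T))) neqT' s' T's'.
  by rewrite s'r'y (ss'.2 y) ?(rr'.2 y) ?wsP // => ? /esym.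
Qed.

Lemma definable_excl (L : signature) (P : pred atom) :
  (forall xs ys, definable L P (Indep xs [::] ys)) ->
  (forall xs ys, 0 < size xs -> size xs = size ys -> definable L P (Incl xs ys)) ->
  forall xs ys, 0 < size xs -> size xs = size ys -> definable L P (Excl xs ys).
Proof.
move=> pure incl [//|x xs] [//|y ys] _ [sxy].
have [ws [sz uniq_ws wsP]] := fresh_vars ((x :: xs) ++ y :: ys) (size xs).+1.
case: ws sz uniq_ws wsP => [|w ws] // [sz] uniq_ws wsP.
have xsP : {in x :: xs, forall z, z \notin w :: ws}.
  by move=> z zxs; apply: wsP; rewrite mem_cat zxs.
have ysP : {in y :: ys, forall z, z \notin w :: ws}.
  by move=> z zys; apply: wsP; rewrite mem_cat zys orbT.
set S := (w :: ws) ++ (x :: xs) ++ y :: ys.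
have xsS : {subset x :: xs <= S} by move=> z zz; rewrite !mem_cat zz orbT.
have ysS : {subset y :: ys <= S} by move=> z zz; rewrite !mem_cat zz !orbT.
have wsS : {subset w :: ws <= S} by move=> z zz; rewrite mem_cat zz.
pose inc := Incl (y :: ys) (w :: ws).
pose ind := Indep (x :: xs) [::] (w :: ws).
apply: (@definable_by L P
  (Exs (w :: ws) (And (Atm inc) (And (Atm ind) (NeqT L x w xs ws))))).
- apply: in_FO_Exs; split; first by apply/asboolP/incl; rewrite //= -sxy sz.
  by split; [exact/asboolP/pure|exact: in_FO_NeqT].
- apply: free_vars_Exs; apply: free_vars_And.
    by apply: free_vars_Atm => v; rewrite (mem_cat v (y :: ys)) => /orP[/ysS|/wsS].
  apply: free_vars_And; last exact: free_vars_NeqT.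
  by apply: free_vars_Atm => v; rewrite (mem_cat v (x :: xs)) => /orP[/xsS|/wsS].
move=> M Minf T Txy.
have flat_mat := @flat_NeqT L M S x w xs ws (esym sz) xsS wsS.
split=> [H|/sat_Exs[T' [T'T TT'] [incT' [indT' neqT']]] s r Ts Tr sr].
- pose Phi := [set s' : assignment M |
    exists2 r, T r & tuple_val r (y :: ys) = tuple_val s' (w :: ws)].
  have ext (s r : assignment M) : T s -> T r -> exists2 s', variant (w :: ws) s s' &
      tuple_val r (y :: ys) = tuple_val s' (w :: ws).
    move=> Ts Tr.
    have [|t rt] := tuple_val_some (xs := y :: ys) Txy Tr.
      by move=> z zys; rewrite mem_cat zys orbT.
    have szt : size t = size (w :: ws).
      by rewrite -(size_map some t) -rt size_map /= -sxy sz.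
    have [s' ss' s't] := variant_tuple_exists s uniq_ws szt.
    by exists s' => //; rewrite rt.
  have TT' : variation (w :: ws) T (restricted_variation (w :: ws) T Phi).
    apply: variation_restricted => s Ts; have [s' ss' sE] := ext s s Ts Ts.
    by exists s' => //; exists s.
  apply/sat_Exs; exists (restricted_variation (w :: ws) T Phi) => //.
  split; last split.
  + move=> s' [_ [s Ts ss']]; have [r' sr' sE] := ext s s Ts Ts.
    exists r'; first by split; [exists s|exists s].
    by rewrite (variant_tuple ss').
  + move=> s' r' [_ [s Ts ss']] [[q Tq qr'] _] _.
    have [s'' ss'' qs''] := ext s q Ts Tq.
    exists s''; split=> //; first by split; [exists q|exists s].
      by rewrite (variant_tuple ss'') // (variant_tuple ss').
    by rewrite -qs''.
  + apply/flat_mat => [|s' [[r Tr rs'] [s Ts ss']]].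
      exact: defined_on_variant Txy TT'.1.
    by rewrite -rs' (variant_tuple ss') //; exact: H.
- have [s' T's' ss'] := TT' s Ts; have [r' T'r' rr'] := TT' r Tr.
  have [q T'q rq] := incT' r' T'r'.
  have [p [T'p _ ps' pq]] := indT' _ _ T's' T'q erefl.
  apply: (proj1 (flat_mat _ (defined_on_variant Txy T'T)) neqT' p T'p).
  by rewrite ps' pq -rq (variant_tuple ss') // (variant_tuple rr').
Qed.

(** * Conditional independence *)

Lemma definable_indep1 (L : signature) (P : pred atom) :
  (forall xs ys, definable L P (Indep xs [::] ys)) ->
  (forall xs ys, 0 < size xs -> size xs = size ys -> definable L P (Incl xs ys)) ->
  forall x z y, definable L P (Indep [:: x] [:: z] [:: y]).
Proof.
move=> pure incl x z y.
have [ws [sz uniq_ws wsP]] := fresh_vars [:: x; z; y] 2.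
case: ws sz uniq_ws wsP => [|z' [|y' [|//]]] // _ uniq_ws wsP.
pose ind := Indep [:: z; x; y] [::] [:: z'; y'].
pose inc := Incl [:: z; y] [:: z'; y'].
pose mix := Incl [:: z; x; y'] [:: z; x; y].
apply: (@definable_by L P (Exs [:: z'; y']
  (And (Atm ind) (And (Atm inc) (Or (NeqV z z') (Atm mix)))))).
- by split; [exact/asboolP/pure|do !split=> //; exact/asboolP/incl].
- apply/free_vars_Exs/free_vars_And.
    by apply/free_vars_Atm/allP; rewrite /= !inE !eqxx ?orbT.
  apply: free_vars_And.
    by apply/free_vars_Atm/allP; rewrite /= !inE !eqxx ?orbT.
  apply: free_vars_Or; first by apply: free_vars_NeqV; rewrite !inE eqxx ?orbT.
  by apply/free_vars_Atm/allP; rewrite /= !inE !eqxx ?orbT.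
move=> M Minf T Txzy.
have xzyE (s s' : assignment M) : variant [:: z'; y'] s s' ->
    [/\ fnd s' x = fnd s x, fnd s' z = fnd s z & fnd s' y = fnd s y].
  by move=> ss'; split; apply: ss'.2; apply: wsP; rewrite !inE eqxx ?orbT.
have flat_mat : flat_on [:: z', y' & [:: x; z; y]] (NeqV z z' : formula L)
    (fun s : assignment M => fnd s z <> fnd s z').
  by apply: flat_NeqV; rewrite !inE eqxx ?orbT.
split=> [H|/sat_Exs[T' [T'T TT'] [indT' [incT' [U [V [T'UV neqU mixV]]]]]]
    s r Ts Tr [szrz]].
- pose Phi := [set s' : assignment M |
    exists2 r, T r & fnd r z = fnd s' z' /\ fnd r y = fnd s' y'].
  have ext (s r : assignment M) : T s -> T r -> exists2 s', variant [:: z'; y'] s s' &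
      fnd r z = fnd s' z' /\ fnd r y = fnd s' y'.
    move=> Ts Tr.
    have [|a ra] := fnd_some (x := z) Txzy Tr; first by rewrite !inE eqxx orbT.
    have [|b rb] := fnd_some (x := y) Txzy Tr; first by rewrite !inE eqxx !orbT.
    have [s' ss' [s'z' s'y']] :=
      @variant_tuple_exists M [:: z'; y'] s [:: a; b] uniq_ws erefl.
    by exists s' => //; rewrite ra rb.
  set T' := restricted_variation [:: z'; y'] T Phi.
  have TT' : variation [:: z'; y'] T T'.
    apply: variation_restricted => s Ts; have [s' ss' sE] := ext s s Ts Ts.
    by exists s' => //; exists s.
  have T'ext s r : T s -> T r -> exists2 s', T' s' &
      variant [:: z'; y'] s s' /\ fnd r z = fnd s' z' /\ fnd r y = fnd s' y'.
    move=> Ts Tr; have [s' ss' sE] := ext s r Ts Tr; exists s' => //.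
    by split; [exists r|exists s].
  apply/sat_Exs; exists T' => //; split; last split.
  + move=> s' r' [_ [s Ts ss']] [[q Tq [qz qy]] _] _.
    have [s'' T's'' [ss'' [qz' qy']]] := T'ext s q Ts Tq.
    exists s''; split=> //=; last by rewrite -qz' -qy' qz qy.
    by have [-> -> ->] := xzyE _ _ ss''; have [-> -> ->] := xzyE _ _ ss'.
  + move=> s' [_ [s Ts ss']]; have [r' T'r' [_ [rz ry]]] := T'ext s s Ts Ts.
    by exists r' => //=; have [_ -> ->] := xzyE _ _ ss'; rewrite rz ry.
  + exists (T' `&` [set s : assignment M | fnd s z <> fnd s z']),
      (T' `&` [set s : assignment M | fnd s z = fnd s z']).
    split.
    * apply/seteqP; split=> s; last by case=> -[].
      by move=> T's; have [e|] := pselect (fnd s z = fnd s z'); [right|left].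
    * apply/flat_mat => [|s []//] s v [T's _].
      exact: (defined_on_variant Txzy TT'.1 T's).
    * move=> s' [[[r Tr [rz ry]] [s Ts ss']] zz'].
      have [s'x s'z _] := xzyE _ _ ss'.
      have [|q [Tq [qz] [qx] [qy]]] := H s r Ts Tr; first by rewrite /= rz -zz' s'z.
      have [q' T'q' [qq' [qz' qy']]] := T'ext q q Tq Tq.
      have [q'x q'z q'y] := xzyE _ _ qq'.
      exists q'; first by split=> //=; rewrite q'z.
      by rewrite /= s'z s'x -ry q'z q'x q'y qz qx qy.
- have [s' T's' ss'] := TT' s Ts; have [r' T'r' rr'] := TT' r Tr.
  have [q T'q [rqz rqy]] := incT' r' T'r'.
  have [p [T'p _ [pz px _] [pz' py']]] := indT' _ _ T's' T'q erefl.
  have [s'x s'z _] := xzyE _ _ ss'; have [_ r'z r'y] := xzyE _ _ rr'.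
  have Vp : V p.
    have : (U `|` V) p by rewrite -T'UV.
    case=> // Up; have Udef : defined_on [:: z', y' & [:: x; z; y]] U.
      move=> u v Uu; apply: (defined_on_variant Txzy T'T); rewrite T'UV; by left.
    case: (proj1 (flat_mat _ Udef) neqU p Up).
    by rewrite pz pz' -rqz s'z r'z.
  have [o Vo [poz pox poy]] := mixV p Vp.
  have [|o0 To0 o0o] := T'T o; first by rewrite T'UV; right.
  have [o0x o0z o0y] := xzyE _ _ o0o.
  exists o0; split=> //=.
  + by rewrite -o0z -poz pz s'z.
  + by rewrite -o0x -pox px s'x.
  + by rewrite -o0y -poy py' -rqy r'y.
Qed.

Theorem theorem8p1 (L : signature) :
  (forall (xs : seq var) (y : var),
     exists phi : formula L,
       [/\ in_FO (kary_dep 2) phi,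
           free_vars phi `<=` [set` atom_vars (Dep xs y)]
         & defines_on_infinite phi (Dep xs y)])
  /\
  (forall a : atom, wf_atom a ->
     exists phi : formula L,
       [/\ in_FO ternary_indep phi,
           free_vars phi `<=` [set` atom_vars a]
         & defines_on_infinite phi a]).
Proof.
split; first by apply: definable_dep => x y z; exact: definable_atom.
have d3 x y z u v w : definable L ternary_indep (Indep [:: x; y; z] [::] [:: u; v; w]).
  exact: definable_atom.
have dep := definable_dep (definable_indep3_dep2 d3).
have pure := definable_pure_indep d3.
have incl := definable_incl pure.
case=> [xs y|xs ys|xs ys|xs y|xs zs ys] /=; rewrite -/(definable L ternary_indep _).
- by move=> _; exact: dep.
- by move=> /andP[/eqP]; move=> ? ?; exact: definable_excl.
- by move=> /andP[/eqP]; move=> ? ?; exact: incl.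
- by move=> _; exact: definable_anon.
- move=> _; apply: (definable_indep_code dep); left=> p.
  apply: (definable_indep_code dep); right; left=> r.
  apply: (definable_indep_code dep); right; right=> q.
  exact: definable_indep1.
Qed.
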